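(* Let $e\in C^*$ be an idempotent and let $S:\mathcal{M}^{eCe}\to\mathcal{M}^C$ be the associated section functor. Then: (a) $S$ preserves injective comodules. (b) If $N$ is a quasi-finite indecomposable right $eCe$-comodule, then $S(N)$ is indecomposable. (c) $S$ preserves indecomposable injective comodules. (d) If $S_x$ is a simple $eCe$-comodule, then $\operatorname{Soc} S(S_x)=S_x$. (e) If $S_x$ is a simple $eCe$-comodule, then $S(S_x)$ is torsion-free. (f) $S(\overline{E}_x)=E_x$ for all $x\in I_e$. (g) $S$ preserves quasi-finite comodules. (h) $S$ restricts to a fully faithful functor $S:\mathcal{M}^{eCe}_{qf}\to\mathcal{M}^C_{qf}$ between the categories of quasi-finite comodules, which preserves indecomposable comodules and respects isomorphism classes.
   Context: Let $K$ be a field and $C$ a basic $K$-coalgebra (the socle of the right $C$-comodule $C$ is a direct sum of pairwise non-isomorphic simple comodules), which is also assumed indecomposable as a coalgebra. All comodules are right comodules; $\mathcal{M}^C$ is the category of right $C$-comodules and $\mathcal{M}^C_{qf}$ its full subcategory of quasi-finite comodules ($M$ is quasi-finite if $\operatorname{Hom}_C(F,M)$ is finite dimensional for every finite dimensional $F$). $\{S_x\}_{x\in I_C}$ is a complete set of pairwise non-isomorphic simple right $C$-comodules, $E_x$ is the injective envelope of $S_x$. Equalities between comodules are understood up to isomorphism. For an idempotent $e\in C^*$, $e$ acts on a right comodule $M$ by $em=\sum m_{(0)}e(m_{(1)})$, and on $C$ by $ec=\sum c_{(1)}e(c_{(2)})$, $ce=\sum e(c_{(1)})c_{(2)}$. The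 space $eCe$ is a coalgebra with $\Delta(ece)=\sum ec_{(1)}e\otimes ec_{(2)}e$ and counit the restriction of that of $C$. The quotient functor is the exact functor $T:\mathcal{M}^C\to\mathcal{M}^{eCe}$, $T(M)=eM\cong M\square_C eC$, and the section functor is its right adjoint $S(N)=N\square_{eCe}Ce$, which is fully faithful and left exact with $TS\cong 1$. A $C$-comodule $M$ is torsion if $T(M)=0$, and torsion-free if it has no non-zero torsion subcomodule. Put $I_e=\{x\in I_C: T(S_x)\neq0\}$; the comodules $T(S_x)$, $x\in I_e$, again denoted $S_x$, form a complete set of pairwise non-isomorphic simple $eCe$-comodules, and $\overline{E}_x$ is the injective envelope of $S_x$ in $\mathcal{M}^{eCe}$. *)

(* Defs.v *)
From HB Require Import structures.
From mathcomp Require Import all_boot all_order all_algebra.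
From mathcomp Require Import boolp classical_sets.

Set Implicit Arguments.
Unset Strict Implicit.
Unset Printing Implicit Defensive.

Import GRing.Theory.
Local Open Scope quotient_scope.
Local Open Scope ring_scope.

Definition lin_of (K : fieldType) (U V : lmodType K) (f : U -> V)
    (fL : linear f) : {linear U -> V} :=
  HB.pack_for {linear U -> V} f (GRing.isLinear.Build K U V *:%R f fL).

Lemma lin_ofE (K : fieldType) (U V : lmodType K) (f : U -> V) (fL : linear f) :
  lin_of fL =1 f.
Proof. by []. Qed.

Definition lin_id (K : fieldType) (U : lmodType K) : {linear U -> U} := idfun.

Record vsub (K : fieldType) (U : lmodType K) := VSub {
  vsub_mem :> U -> Prop;
  vsub0 : vsub_mem 0;
  vsubL : forall a x y, vsub_mem x -> vsub_mem y -> vsub_mem (a *: x + y) }.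

Section SubspaceType.
Context (K : fieldType) (U : lmodType K) (S : vsub U).

Definition vsub_pred : {pred U} := fun x => `[< S x >].

Lemma vsub_pred_closed : submod_closed vsub_pred.
Proof.
split; first by apply/asboolP; exact: vsub0.
by move=> a x y /asboolP Sx /asboolP Sy; apply/asboolP; apply: vsubL.
Qed.

HB.instance Definition _ :=
  GRing.isSubmodClosed.Build K U vsub_pred vsub_pred_closed.

Record vsub_sort := VSubType { vsub_val :> U; _ : vsub_val \in vsub_pred }.

HB.instance Definition _ := [isSub for vsub_val].
HB.instance Definition _ := [Choice of vsub_sort by <:].
HB.instance Definition _ := [SubChoice_isSubLmodule of vsub_sort by <:].

Definition vsub_type : lmodType K := vsub_sort.

Definition vsub_in (x : U) (Sx : S x) : vsub_type := VSubType (asboolT Sx).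

Lemma vsub_valP (x : vsub_type) : S (vsub_val x).
Proof. by case: x => x /= /asboolP. Qed.

Lemma vsub_val_linear : linear vsub_val.
Proof. by []. Qed.

Definition vsub_incl : {linear vsub_type -> U} := lin_of vsub_val_linear.

Lemma vsub_incl_inj : injective vsub_incl.
Proof. exact: val_inj. Qed.
End SubspaceType.

Section Image.
Context (K : fieldType) (U V : lmodType K) (f : {linear U -> V}).

Lemma lin_image_closed a (x y : V) : (exists u, f u = x) ->
  (exists u, f u = y) -> exists u, f u = a *: x + y.
Proof. by move=> [u <-] [v <-]; exists (a *: u + v); rewrite linearP. Qed.

Definition lin_image : vsub V :=
  @VSub K V (fun y => exists x, f x = y) (ex_intro _ 0 (linear0 f))
    lin_image_closed.

Lemma lin_image_mem x : lin_image (f x). Proof. by exists x. Qed.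

Lemma to_image_linear : linear (fun x => vsub_in (lin_image_mem x)).
Proof. by move=> a x y; apply: val_inj; rewrite /= linearP. Qed.

Definition to_image : {linear U -> vsub_type lin_image} :=
  lin_of to_image_linear.

Lemma to_imageE x : vsub_incl _ (to_image x) = f x. Proof. by []. Qed.

Lemma to_image_surj y : exists x, to_image x = y.
Proof. by have [x fx] := vsub_valP y; exists x; apply: val_inj. Qed.
End Image.

Definition bilin (K : fieldType) (U V W : lmodType K) (f : U -> V -> W) :=
  (forall v, linear (f^~ v)) /\ (forall u, linear (f u)).

Section Tensor.
Context (K : fieldType) (U V : lmodType K).

Definition fsum_eval (W : lmodType K) (f : U -> V -> W) (s : seq (U * V)) : W :=
  \sum_(p <- s) f p.1 p.2.

(* A tensor is a class of formal sums of pairs, two formal sums being identified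
   when every bilinear map takes the same value on them. *)
Definition fsum_eq (s t : seq (U * V)) : bool :=
  `[< forall (W : lmodType K) (f : U -> V -> W),
        bilin f -> fsum_eval f s = fsum_eval f t >].

Lemma fsum_eq_refl : reflexive fsum_eq.
Proof. by move=> s; apply/asboolP. Qed.

Lemma fsum_eq_sym : symmetric fsum_eq.
Proof. by move=> s t; apply/asboolP/asboolP => h W f /h. Qed.

Lemma fsum_eq_trans : transitive fsum_eq.
Proof.
by move=> t s r /asboolP h /asboolP k; apply/asboolP => W f fB; rewrite h ?k.
Qed.

Canonical fsum_equiv := EquivRel fsum_eq fsum_eq_refl fsum_eq_sym fsum_eq_trans.

Definition tens_type := {eq_quot fsum_eq}.
HB.instance Definition _ := Choice.on tens_type.
HB.instance Definition _ := Quotient.on tens_type.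

Definition of_fsum (s : seq (U * V)) : tens_type := \pi_tens_type s.

Lemma of_fsum_eq s t : of_fsum s = of_fsum t <->
  forall (W : lmodType K) (f : U -> V -> W),
    bilin f -> fsum_eval f s = fsum_eval f t.
Proof. by split=> [/eqquotP/asboolP|h]; last by apply/eqquotP/asboolP. Qed.

Lemma of_fsumK (x : tens_type) : of_fsum (repr x) = x.
Proof. exact: reprK. Qed.

Definition fsum_scale (a : K) (s : seq (U * V)) := [seq (a *: p.1, p.2) | p <- s].

Lemma fsum_eval_cat (W : lmodType K) (f : U -> V -> W) s t :
  fsum_eval f (s ++ t) = fsum_eval f s + fsum_eval f t.
Proof. by rewrite /fsum_eval big_cat. Qed.

Lemma bilinZl (W : lmodType K) (f : U -> V -> W) a u v :
  bilin f -> f (a *: u) v = a *: f u v.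
Proof.
case=> /(_ v) fL _.
have f0 : f 0 v = 0.
  by have := fL (-1) 0 0; rewrite scaler0 addr0 scaleN1r addNr.
by have := fL a u 0; rewrite !addr0 f0 addr0.
Qed.

Lemma fsum_eval_scale (W : lmodType K) (f : U -> V -> W) a s :
  bilin f -> fsum_eval f (fsum_scale a s) = a *: fsum_eval f s.
Proof.
move=> fB; rewrite /fsum_eval big_map scaler_sumr.
by apply: eq_bigr => p _; rewrite /= bilinZl.
Qed.

Definition tens_zero : tens_type := of_fsum [::].
Definition tens_add (x y : tens_type) : tens_type := of_fsum (repr x ++ repr y).
Definition tens_scale (a : K) (x : tens_type) : tens_type := of_fsum (fsum_scale a (repr x)).
Definition tens_opp (x : tens_type) : tens_type := tens_scale (-1) x.

Lemma repr_of_fsum (W : lmodType K) (f : U -> V -> W) s :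
  bilin f -> fsum_eval f (repr (of_fsum s)) = fsum_eval f s.
Proof. by move: W f; apply/of_fsum_eq; rewrite of_fsumK. Qed.

Lemma tens_addE s t : tens_add (of_fsum s) (of_fsum t) = of_fsum (s ++ t).
Proof.
by apply/of_fsum_eq => W f fB; rewrite !fsum_eval_cat !repr_of_fsum.
Qed.

Lemma tens_scaleE a s : tens_scale a (of_fsum s) = of_fsum (fsum_scale a s).
Proof.
by apply/of_fsum_eq => W f fB; rewrite !fsum_eval_scale ?repr_of_fsum.
Qed.

Lemma tens_addA : associative tens_add.
Proof.
move=> x y z; rewrite -(of_fsumK x) -(of_fsumK y) -(of_fsumK z).
by rewrite !tens_addE catA.
Qed.

Lemma tens_addC : commutative tens_add.
Proof.
move=> x y; rewrite -(of_fsumK x) -(of_fsumK y) !tens_addE.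
by apply/of_fsum_eq => W f fB; rewrite !fsum_eval_cat addrC.
Qed.

Lemma tens_add0 : left_id tens_zero tens_add.
Proof. by move=> x; rewrite -(of_fsumK x) tens_addE. Qed.

Lemma tens_addN : left_inverse tens_zero tens_opp tens_add.
Proof.
move=> x; rewrite -(of_fsumK x) /tens_opp tens_scaleE tens_addE.
apply/of_fsum_eq => W f fB.
by rewrite fsum_eval_cat fsum_eval_scale // scaleN1r addNr /fsum_eval big_nil.
Qed.

HB.instance Definition _ :=
  GRing.isZmodule.Build tens_type tens_addA tens_addC tens_add0 tens_addN.

Lemma tens_addrE (x y : tens_type) : x + y = tens_add x y.
Proof. by []. Qed.

Lemma tens_scaleA a b x : tens_scale a (tens_scale b x) = tens_scale (a * b) x.
Proof.
rewrite -(of_fsumK x) !tens_scaleE; apply/of_fsum_eq => W f fB.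
by rewrite !fsum_eval_scale // scalerA.
Qed.

Lemma tens_scale1 : left_id 1 tens_scale.
Proof.
move=> x; rewrite -(of_fsumK x) !tens_scaleE; apply/of_fsum_eq => W f fB.
by rewrite fsum_eval_scale // scale1r.
Qed.

Lemma tens_scaleDr : right_distributive tens_scale +%R.
Proof.
move=> a x y; rewrite -(of_fsumK x) -(of_fsumK y) !tens_addrE.
rewrite tens_addE !tens_scaleE tens_addE; apply/of_fsum_eq => W f fB.
by rewrite !(fsum_eval_scale, fsum_eval_cat) // scalerDr.
Qed.

Lemma tens_scaleDl x : {morph tens_scale^~ x : a b / a + b}.
Proof.
move=> a b; rewrite -(of_fsumK x) tens_addrE.
rewrite !tens_scaleE tens_addE; apply/of_fsum_eq => W f fB.
by rewrite !(fsum_eval_scale, fsum_eval_cat) // scalerDl.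
Qed.

HB.instance Definition _ := GRing.Zmodule_isLmodule.Build K tens_type
  tens_scaleA tens_scale1 tens_scaleDr tens_scaleDl.

Definition tens : lmodType K := tens_type.

Lemma tens_scalerE a (x : tens) : a *: x = tens_scale a x.
Proof. by []. Qed.

Definition pure (u : U) (v : V) : tens := of_fsum [:: (u, v)].

Lemma pure_bilin : bilin pure.
Proof.
split=> [v a x y|u a x y];
  rewrite /pure tens_addrE tens_scalerE tens_scaleE tens_addE;
  apply/of_fsum_eq => W f fB; rewrite /fsum_eval !big_cons !big_nil !addr0 /=.
- by rewrite (fB.1 v) bilinZl.
- by rewrite (fB.2 u) bilinZl //; have := fB.1 x; case: fB => _ /(_ u).
Qed.

Lemma of_fsumE s : of_fsum s = \sum_(p <- s) pure p.1 p.2.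
Proof.
elim: s => [|p s IHs]; first by rewrite big_nil.
by rewrite big_cons -IHs tens_addrE tens_addE -surjective_pairing.
Qed.

Lemma tens_sum (x : tens) : exists s, x = \sum_(p <- s) pure p.1 p.2.
Proof. by exists (repr x); rewrite -of_fsumE of_fsumK. Qed.

Lemma tens_ind (P : tens -> Prop) : P 0 -> (forall u v, P (pure u v)) ->
  (forall x y, P x -> P y -> P (x + y)) -> forall x, P x.
Proof.
move=> P0 Pp PD x; have [s ->] := tens_sum x.
by elim/big_ind: _.
Qed.

Section Lift.
Context (W : lmodType K) (f : U -> V -> W) (fB : bilin f).

Lemma tlift_linear : linear (fun x : tens => fsum_eval f (repr x)).
Proof.
move=> a x y; rewrite tens_addrE tens_scalerE.
by rewrite repr_of_fsum // fsum_eval_cat repr_of_fsum // fsum_eval_scale.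
Qed.

Lemma tlift_exists :
  exists g : {linear tens -> W}, forall u v, g (pure u v) = f u v.
Proof.
exists (lin_of tlift_linear) => u v.
by rewrite lin_ofE repr_of_fsum // /fsum_eval big_seq1.
Qed.

Definition tlift : {linear tens -> W} := projT1 (cid tlift_exists).

Lemma tliftE u v : tlift (pure u v) = f u v.
Proof. exact: projT2 (cid tlift_exists) u v. Qed.
End Lift.

Lemma tens_ext (W : lmodType K) (f g : {linear tens -> W}) :
  (forall u v, f (pure u v) = g (pure u v)) -> f =1 g.
Proof.
move=> fg; apply: tens_ind => [|//|x y fx fy]; first by rewrite !linear0.
by rewrite !linearD fx fy.
Qed.

Lemma pureDl u u' v : pure (u + u') v = pure u v + pure u' v.
Proof. by have := pure_bilin.1 v 1 u u'; rewrite !scale1r. Qed.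

Lemma pureZl a u v : pure (a *: u) v = a *: pure u v.
Proof. exact: bilinZl pure_bilin. Qed.

Lemma pureDr u v v' : pure u (v + v') = pure u v + pure u v'.
Proof. by have := pure_bilin.2 u 1 v v'; rewrite !scale1r. Qed.

Lemma pure0r u : pure u 0 = 0.
Proof. by apply: (addrI (pure u 0)); rewrite -pureDr !addr0. Qed.

Lemma pure0l v : pure 0 v = 0.
Proof. by apply: (addrI (pure 0 v)); rewrite -pureDl !addr0. Qed.

Lemma pureZr a u v : pure u (a *: v) = a *: pure u v.
Proof. by have := pure_bilin.2 u a v 0; rewrite pure0r !addr0. Qed.
End Tensor.

Arguments tlift : simpl never.

Section TensorMap.
Context (K : fieldType) (U V U' V' : lmodType K).

Lemma tmap_bilin (f : {linear U -> U'}) (g : {linear V -> V'}) :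
  bilin (fun u v => pure (f u) (g v)).
Proof.
split=> [v a x y|u a x y] /=; rewrite linearP; first exact: (pure_bilin _ _).1.
exact: (pure_bilin _ _).2.
Qed.

Definition tmap (f : {linear U -> U'}) (g : {linear V -> V'}) :
  {linear tens U V -> tens U' V'} := tlift (tmap_bilin f g).

Lemma tmapE f g u v : tmap f g (pure u v) = pure (f u) (g v).
Proof. exact: tliftE. Qed.
End TensorMap.
Arguments tmap : simpl never.

Section TensorMapTheory.
Context (K : fieldType).
Implicit Types U V : lmodType K.

Lemma tmap_id U V (f : {linear U -> U}) (g : {linear V -> V}) :
  f =1 id -> g =1 id -> tmap f g =1 id.
Proof.
move=> f1 g1; apply: (tens_ext (g := lin_id _)) => u v.
by rewrite tmapE f1 g1.
Qed.

Lemma tmap_comp U V U1 V1 U2 V2 (f : {linear U -> U1}) (g : {linear V -> V1})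
    (f' : {linear U1 -> U2}) (g' : {linear V1 -> V2}) x :
  tmap f' g' (tmap f g x) = tmap (f' \o f) (g' \o g) x.
Proof.
rewrite -[LHS]/((tmap f' g' \o tmap f g) x); move: x.
by apply: tens_ext => u v; rewrite /= !tmapE.
Qed.

Lemma eq_tmap U V U1 V1 (f f' : {linear U -> U1}) (g g' : {linear V -> V1}) :
  f =1 f' -> g =1 g' -> tmap f g =1 tmap f' g'.
Proof. by move=> ff gg; apply: tens_ext => u v; rewrite !tmapE ff gg. Qed.

Lemma tmap_cancel U V U1 V1 (f : {linear U -> U1}) (g : {linear V -> V1})
    (f' : {linear U1 -> U}) (g' : {linear V1 -> V}) :
  cancel f f' -> cancel g g' -> cancel (tmap f g) (tmap f' g').
Proof. by move=> fK gK x; rewrite tmap_comp tmap_id. Qed.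
End TensorMapTheory.

Section Assoc.
Context (K : fieldType) (U V W : lmodType K).

Lemma pure_linl (A B : lmodType K) (b : B) : linear (fun a : A => pure a b).
Proof. exact: (pure_bilin _ _).1. Qed.
Definition pure_l A B b := lin_of (@pure_linl A B b).

Lemma pure_linr (A B : lmodType K) (a : A) : linear (fun b : B => pure a b).
Proof. exact: (pure_bilin _ _).2. Qed.
Definition pure_r A B a := lin_of (@pure_linr A B a).

Lemma tassoc_bilin : bilin (fun (x : tens U V) (w : W) =>
  tmap (lin_id U) (pure_l V w) x).
Proof.
split=> [w a x y|x a w w']; first by rewrite linearP.
elim/(@tens_ind K U V): x => [|u v|x y IHx IHy].
- by rewrite !linear0 ?scaler0 addr0.
- by rewrite !tmapE /= (pure_bilin _ _).2 (pure_bilin _ _).2.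
- by rewrite !linearD IHx IHy /= addrACA.
Qed.

Definition tassoc : {linear tens (tens U V) W -> tens U (tens V W)} :=
  tlift tassoc_bilin.

Lemma tassocE u v w : tassoc (pure (pure u v) w) = pure u (pure v w).
Proof. by rewrite /tassoc tliftE tmapE. Qed.

Lemma tassocV_bilin : bilin (fun (u : U) (x : tens V W) =>
  tmap (pure_r V u) (lin_id W) x).
Proof.
split=> [x a u u'|u a x y]; last by rewrite linearP.
elim/(@tens_ind K V W): x => [|v w|x y IHx IHy].
- by rewrite !linear0 ?scaler0 addr0.
- by rewrite !tmapE /= (pure_bilin _ _).1 (pure_bilin _ _).1.
- by rewrite !linearD IHx IHy /= addrACA.
Qed.

Definition tassocV : {linear tens U (tens V W) -> tens (tens U V) W} :=
  tlift tassocV_bilin.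

Lemma tassocVE u v w : tassocV (pure u (pure v w)) = pure (pure u v) w.
Proof. by rewrite /tassocV tliftE tmapE. Qed.
End Assoc.
Arguments tassoc {K U V W} : simpl never.
Arguments tassocV {K U V W} : simpl never.

Section Tensor3.
Context (K : fieldType).
Implicit Types U V W X : lmodType K.

Lemma tens3_ext U V W X (f g : {linear tens (tens U V) W -> X}) :
  (forall u v w, f (pure (pure u v) w) = g (pure (pure u v) w)) -> f =1 g.
Proof.
move=> fg; apply: tens_ext => x w.
pose h := pure_l (tens U V) w.
exact: (tens_ext (f := f \o h) (g := g \o h)) (fun u v => fg u v w) x.
Qed.

Lemma tens3r_ext U V W X (f g : {linear tens U (tens V W) -> X}) :
  (forall u v w, f (pure u (pure v w)) = g (pure u (pure v w))) -> f =1 g.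
Proof.
move=> fg; apply: tens_ext => u x.
pose h := pure_r (tens V W) u.
exact: (tens_ext (f := f \o h) (g := g \o h)) (fg u) x.
Qed.

Lemma tassocK U V W : cancel (@tassoc K U V W) (@tassocV K U V W).
Proof.
apply: (tens3_ext (f := @tassocV K U V W \o @tassoc K U V W) (g := lin_id _)).
by move=> u v w; rewrite /= tassocE tassocVE.
Qed.

Lemma tassocVK U V W : cancel (@tassocV K U V W) (@tassoc K U V W).
Proof.
apply: (tens3r_ext (f := @tassoc K U V W \o @tassocV K U V W) (g := lin_id _)).
by move=> u v w; rewrite /= tassocVE tassocE.
Qed.

Lemma tassoc_nat U V W U' V' W' (f : {linear U -> U'}) (g : {linear V -> V'})
    (h : {linear W -> W'}) x :
  tassoc (tmap (tmap f g) h x) = tmap f (tmap g h) (tassoc x).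
Proof.
rewrite -[LHS]/((@tassoc K _ _ _ \o tmap (tmap f g) h) x).
rewrite -[RHS]/((tmap f (tmap g h) \o @tassoc K _ _ _) x).
move: x; apply: tens3_ext => u v w /=.
by rewrite !(tmapE, tassocE).
Qed.

Lemma tassoc_natl U V W U' (f : {linear U -> U'}) x :
  tassoc (tmap (tmap f (lin_id V)) (lin_id W) x) =
  tmap f (lin_id (tens V W)) (tassoc x).
Proof. by rewrite tassoc_nat; apply: eq_tmap => //; exact: tmap_id. Qed.

Lemma tassocV_nat U V W U' V' W' (f : {linear U -> U'}) (g : {linear V -> V'})
    (h : {linear W -> W'}) x :
  tassocV (tmap f (tmap g h) x) = tmap (tmap f g) h (tassocV x).
Proof.
by apply: (can_inj (@tassocK _ _ _)); rewrite tassocVK tassoc_nat tassocVK.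
Qed.

Lemma tassocV_natl U V W U' (f : {linear U -> U'}) x :
  tassocV (tmap f (lin_id (tens V W)) x) =
  tmap (tmap f (lin_id V)) (lin_id W) (tassocV x).
Proof. by rewrite -[x in LHS]tassocVK -tassoc_natl tassocK. Qed.

Lemma tassocV_natr U V W W' (h : {linear W -> W'}) x :
  tassocV (tmap (lin_id U) (tmap (lin_id V) h) x) =
  tmap (lin_id (tens U V)) h (tassocV x).
Proof. by rewrite tassocV_nat; apply: eq_tmap => //; exact: tmap_id. Qed.
End Tensor3.

Section TensorUnit.
Context (K : fieldType) (U : lmodType K).

Lemma tunitl_bilin : bilin (fun (a : K^o) (u : U) => a *: u).
Proof.
split=> [v a x y|u a x y]; first by rewrite scalerDl scalerA.
by rewrite scalerDr !scalerA mulrC.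
Qed.

Definition tunitl : {linear tens K^o U -> U} := tlift tunitl_bilin.

Lemma tunitlE a u : tunitl (pure a u) = a *: u.
Proof. by rewrite /tunitl tliftE. Qed.

Lemma tunitr_bilin : bilin (fun (u : U) (a : K^o) => a *: u).
Proof. by split=> [v a x y|u a x y]; apply tunitl_bilin. Qed.

Definition tunitr : {linear tens U K^o -> U} := tlift tunitr_bilin.

Lemma tunitrE u a : tunitr (pure u a) = a *: u.
Proof. by rewrite /tunitr tliftE. Qed.
End TensorUnit.
Arguments tunitl {K U} : simpl never.
Arguments tunitr {K U} : simpl never.

Section Complement.
Context (K : fieldType) (U : lmodType K) (S : vsub U).
Local Open Scope classical_set_scope.

Definition indep_of (A : set U) :=
  (forall a x y, A x -> A y -> A (a *: x + y)) /\ (forall x, A x -> S x -> x = 0).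

Lemma complement_exists : exists T : vsub U,
  (forall x, T x -> S x -> x = 0) /\
  (forall x, exists y z, [/\ S y, T z & x = y + z]).
Proof.
have [F FI Ftot|A [[AL AS] Amax]] := @Zorn_bigcup U indep_of.
  split=> [a x y [X FX Xx] [Y FY Yy]|x [X FX Xx]]; last first.
    exact: (FI _ FX).2.
  have [XY|YX] := Ftot _ _ FX FY.
    by exists Y => //; apply: (FI _ FY).1 => //; exact: XY.
  by exists X => //; apply: (FI _ FX).1 => //; exact: YX.
have A0 : A 0.
  apply: contrapT => nA0; apply: (Amax (A `|` [set 0])).
    by split=> [x Ax|h]; [left|apply: nA0; apply: h; right].
  split=> [a x y|x].
    move=> [Ax|->] [Ay|->]; rewrite ?scaler0 ?add0r ?addr0; try by [right|left].
    - by left; apply: AL.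
    - left; have := AL (a - 1) x x Ax Ax; rewrite scalerBl scale1r subrK.
      by [].
  by move=> [/AS|->].
exists (VSub A0 AL); split=> // x; apply: contrapT => nx.
have nxE y z : S y -> A z -> x <> y + z.
  by move=> Sy Az xE; apply: nx; exists y, z.
pose B := [set b | exists k a, A a /\ b = k *: x + a].
apply: (Amax B).
  split=> [a Aa|h]; first by exists 0, a; rewrite scale0r add0r.
  have Bx : B x by exists 1, 0; rewrite scale1r addr0.
  by apply: (nxE 0 x (vsub0 S) (h _ Bx)); rewrite add0r.
split=> [c _ _ [k [a [Aa ->]]] [k' [a' [Aa' ->]]]|_ [k [a [Aa ->]]] Sb].
  exists (c * k + k'), (c *: a + a'); split; first exact: (AL).
  by rewrite scalerDr scalerDl scalerA addrACA.
have [k0|k0] := eqVneq k 0.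
  by move: Sb; rewrite k0 scale0r add0r; exact: (AS).
exfalso; apply: (nxE (k^-1 *: (k *: x + a)) (- k^-1 *: a)).
- by have := vsubL k^-1 Sb (vsub0 S); rewrite addr0.
- by have := AL (- k^-1) _ _ Aa A0; rewrite addr0.
- by rewrite scalerDr scalerA mulVf // scale1r scaleNr addrK.
Qed.

Lemma retraction_exists : exists r : {linear U -> vsub_type S},
  cancel (vsub_incl S) r.
Proof.
have [T [TS ST]] := complement_exists.
have /choice[p pP] : forall x, exists y : vsub_type S, T (x - vsub_incl S y).
  move=> x; have [y [z [Sy Tz ->]]] := ST x.
  by exists (vsub_in Sy); rewrite addrC /= addKr.
have pU x (y : vsub_type S) : T (x - vsub_incl S y) -> p x = y.
  move=> Ty; apply/vsub_incl_inj/eqP; rewrite -subr_eq0; apply/eqP/TS.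
    have := vsubL (-1) (pP x) Ty.
    by rewrite scaleN1r opprB addrA subrK.
  by have := vsubL (-1) (vsub_valP y) (vsub_valP (p x)); rewrite scaleN1r addrC.
have pL : linear p.
  move=> a x y; apply: pU; have := vsubL a (pP x) (pP y).
  by rewrite scalerBr addrACA (linearP (vsub_incl S)) opprD.
exists (lin_of pL) => y; apply: pU; rewrite subrr; exact: vsub0.
Qed.

Definition retraction : {linear U -> vsub_type S} := projT1 (cid retraction_exists).

Lemma retractionK : cancel (vsub_incl S) retraction.
Proof. exact: projT2 (cid retraction_exists). Qed.
End Complement.

Section Exactness.
Context (K : fieldType).
Implicit Types U V W X : lmodType K.

Lemma tmap_incl_inj U V (S : vsub U) : injective (tmap (vsub_incl S) (lin_id V)).
Proof.
apply: (can_inj (g := tmap (retraction S) (lin_id V))).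
exact: tmap_cancel (@retractionK _ _ S) _.
Qed.

Definition lin_ker U V (f : {linear U -> V}) : vsub U.
Proof.
exists (fun x => f x = 0); first exact: linear0.
by move=> a x y fx fy; rewrite linearP fx fy scaler0 addr0.
Defined.

Lemma tmap_ker U V W (f : {linear U -> V}) (t : tens U W) :
  tmap f (lin_id W) t = 0 ->
  exists t', tmap (vsub_incl (lin_ker f)) (lin_id W) t' = t.
Proof.
move=> ft; exists (tmap (retraction (lin_ker f)) (lin_id W) t).
have f't : tmap (to_image f) (lin_id W) t = 0.
  apply: (@tmap_incl_inj _ _ (lin_image f)); rewrite tmap_comp linear0 -[RHS]ft.
  exact: eq_tmap.
have /choice[s sP] : forall y, exists x, to_image f x = y.
  exact: to_image_surj.
pose k : {linear U -> U} := vsub_incl (lin_ker f) \o retraction (lin_ker f).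
have kE x : f x = 0 -> k x = x.
  move=> fx; have := retractionK (vsub_in (S := lin_ker f) fx).
  by move/(congr1 (vsub_incl _)).
pose q y := s y - k (s y).
have qE x : q (to_image f x) = x - k x.
  have fsx : f (s (to_image f x) - x) = 0.
    by rewrite linearB -[f (s _)]to_imageE sP to_imageE subrr.
  have := kE _ fsx; rewrite linearB => h; rewrite /q; apply/eqP.
  by rewrite subr_eq -addrA [- _ + _]addrC h addrC subrK.
have qL : linear q.
  move=> a y z; rewrite -(sP y) -(sP z) -linearP !qE linearP scalerBr.
  by rewrite opprD addrACA.
have h : tmap (lin_of qL) (lin_id W) (tmap (to_image f) (lin_id W) t) = 0.
  by rewrite f't linear0.
have E x : x = tmap k (lin_id W) x +
    tmap (lin_of qL) (lin_id W) (tmap (to_image f) (lin_id W) x).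
  elim/(@tens_ind K U W): x => [|u w|x y IHx IHy].
  - by rewrite !linear0 addr0.
  - by rewrite !tmapE lin_ofE qE -pureDl addrC subrK.
  - by rewrite [LHS](congr2 +%R IHx IHy) !linearD addrACA.
by rewrite [RHS]E h addr0 tmap_comp; exact: eq_tmap.
Qed.
End Exactness.

Section TensorIdentities.
Context (K : fieldType).
Implicit Types U V W X : lmodType K.

Lemma tunitr_nat U V (f : {linear U -> V}) (x : tens U K^o) :
  f (tunitr x) = tunitr (tmap f (lin_id _) x).
Proof.
rewrite -[LHS]/((f \o tunitr) x) -[RHS]/((tunitr \o tmap f (lin_id _)) x).
by move: x; apply: tens_ext => u a; rewrite /= tmapE !tunitrE linearZ.
Qed.

Lemma tunitl_nat U V (f : {linear U -> V}) (x : tens K^o U) :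
  f (tunitl x) = tunitl (tmap (lin_id _) f x).
Proof.
rewrite -[LHS]/((f \o tunitl) x) -[RHS]/((tunitl \o tmap (lin_id _) f) x).
by move: x; apply: tens_ext => a u; rewrite /= tmapE !tunitlE linearZ.
Qed.

Lemma tunitlr (x : tens K^o K^o) : tunitl x = tunitr x :> K^o.
Proof.
by move: x; apply: tens_ext => a b; rewrite tunitlE tunitrE [LHS]mulrC.
Qed.

Lemma tunitr_assoc U V W (e : {linear W -> K^o}) (x : tens (tens U V) W) :
  tunitr (tmap (lin_id _) e x) =
  tmap (lin_id U) (tunitr \o tmap (lin_id V) e) (tassoc x).
Proof.
rewrite -[LHS]/((tunitr \o tmap (lin_id _) e) x).
rewrite -[RHS]/((tmap (lin_id U) (tunitr \o tmap (lin_id V) e) \o tassoc) x).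
move: x; apply: tens3_ext => u v w /=.
by rewrite tassocE !tmapE /= tmapE !tunitrE pureZr.
Qed.

Lemma tunitl_assoc U V W (e : {linear U -> K^o}) (x : tens (tens U V) W) :
  tunitl (tmap e (lin_id _) (tassoc x)) =
  tmap (tunitl \o tmap e (lin_id V)) (lin_id W) x.
Proof.
rewrite -[LHS]/((tunitl \o tmap e (lin_id _) \o tassoc) x).
move: x; apply: tens3_ext => u v w /=.
by rewrite tassocE !tmapE /= tmapE !tunitlE pureZl.
Qed.

Lemma tunitr_tassocV U V (x : tens U (tens V K^o)) :
  tunitr (tassocV x) = tmap (lin_id U) tunitr x.
Proof.
rewrite -[LHS]/((tunitr \o tassocV) x).
move: x; apply: tens3r_ext => u v a /=.
by rewrite tassocVE tmapE !tunitrE pureZr.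
Qed.

Lemma pentagon U V W X (x : tens (tens U V) (tens W X)) :
  tmap tassoc (lin_id X) (tassocV x) =
  tassocV (tmap (lin_id U) tassocV (tassoc x)).
Proof.
rewrite -[LHS]/((tmap tassoc (lin_id X) \o tassocV) x).
rewrite -[RHS]/((tassocV \o tmap (lin_id U) tassocV \o tassoc) x).
move: x; apply: tens3r_ext => y w z.
elim/(@tens_ind K U V): y => [|u v|y1 y2 IH1 IH2].
- by rewrite pure0l !linear0.
- by rewrite /= tassocVE tassocE !tmapE !(tassocVE, tassocE).
- by rewrite pureDl !linearD IH1 IH2.
Qed.

Lemma pentagonV U V W X (x : tens U (tens (tens V W) X)) :
  tassoc (tmap tassocV (lin_id X) (tassocV x)) =
  tassocV (tmap (lin_id U) tassoc x).
Proof.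
rewrite -[LHS]/((tassoc \o tmap tassocV (lin_id X) \o tassocV) x).
rewrite -[RHS]/((tassocV \o tmap (lin_id U) tassoc) x).
move: x; apply: tens3r_ext => u y z.
elim/(@tens_ind K V W): y => [|v w|y1 y2 IH1 IH2].
- by rewrite pure0l pure0r !linear0.
- by rewrite /= tassocVE !tmapE !(tassocVE, tassocE).
- by rewrite pureDl pureDr !linearD IH1 IH2.
Qed.
End TensorIdentities.

Record coalgebra (K : fieldType) := Coalgebra {
  coalg_space :> lmodType K;
  comul : {linear coalg_space -> tens coalg_space coalg_space};
  counit : {linear coalg_space -> K^o};
  comulA : forall c,
    tassoc (tmap comul (lin_id _) (comul c)) = tmap (lin_id _) comul (comul c);
  counitl : forall c, tunitl (tmap counit (lin_id _) (comul c)) = c;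
  counitr : forall c, tunitr (tmap (lin_id _) counit (comul c)) = c }.

Arguments comul {K C} : rename.
Arguments counit {K C} : rename.

Record comodule (K : fieldType) (C : coalgebra K) := Comodule {
  comod_space :> lmodType K;
  coact : {linear comod_space -> tens comod_space C};
  coactA : forall m,
    tassoc (tmap coact (lin_id _) (coact m)) = tmap (lin_id _) comul (coact m);
  coact1 : forall m, tunitr (tmap (lin_id _) counit (coact m)) = m }.

Arguments coact {K C M} : rename.

Definition regular (K : fieldType) (C : coalgebra K) : comodule C :=
  Comodule (@comulA K C) (@counitr K C).

Record comod_hom (K : fieldType) (C : coalgebra K) (M N : comodule C) :=
  ComodHom {
    hom_fun :> {linear M -> N};
    hom_coact : forall m, coact (hom_fun m) = tmap hom_fun (lin_id _) (coact m) }.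

Definition hom_id (K : fieldType) (C : coalgebra K) (M : comodule C) :
  comod_hom M M.
Proof. by exists (lin_id M) => m; rewrite tmap_id. Defined.

Definition hom_comp (K : fieldType) (C : coalgebra K) (M N P : comodule C)
  (g : comod_hom N P) (f : comod_hom M N) : comod_hom M P.
Proof.
exists (hom_fun g \o hom_fun f) => m.
by rewrite /= !hom_coact tmap_comp; apply: eq_tmap.
Defined.

Definition comod_iso (K : fieldType) (C : coalgebra K) (M N : comodule C) :=
  exists (f : comod_hom M N) (g : comod_hom N M), cancel f g /\ cancel g f.

Section Subcomodule.
Context (K : fieldType) (C : coalgebra K) (M : comodule C).

Definition is_subcomodule (A : vsub M) := forall x, A x ->
  exists t : tens (vsub_type A) C, tmap (vsub_incl A) (lin_id C) t = coact x.

Record subcomodule := Subcomodule {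
  subcomod_vsub :> vsub M;
  subcomodP : is_subcomodule subcomod_vsub }.

Section Structure.
Context (A : subcomodule).

(* The restriction of the coaction of M; it does not depend on the retraction,
   by [sub_coactE] and the injectivity of A (x) C -> M (x) C. *)
Definition sub_coact : {linear vsub_type A -> tens (vsub_type A) C} :=
  tmap (retraction A) (lin_id C) \o coact \o vsub_incl A.

Lemma sub_coactE x :
  tmap (vsub_incl A) (lin_id C) (sub_coact x) = coact (vsub_incl A x).
Proof.
have [t tE] := subcomodP (vsub_valP x).
by rewrite /= -tE (tmap_cancel (f' := retraction A) (g' := lin_id C)) //;
  exact: retractionK.
Qed.

Lemma sub_coactA x : tassoc (tmap sub_coact (lin_id C) (sub_coact x)) =
  tmap (lin_id _) comul (sub_coact x).
Proof.
apply: (@tmap_incl_inj K M (tens C C) A).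
rewrite -tassoc_natl.
transitivity (tassoc (tmap coact (lin_id C)
    (tmap (vsub_incl A) (lin_id C) (sub_coact x)))).
  congr (tassoc _); rewrite !tmap_comp; apply: eq_tmap => // y.
  exact: sub_coactE.
by rewrite sub_coactE coactA -sub_coactE !tmap_comp; exact: eq_tmap.
Qed.

Lemma sub_coact1 x : tunitr (tmap (lin_id _) counit (sub_coact x)) = x.
Proof.
apply: (@vsub_incl_inj K M A); rewrite tunitr_nat tmap_comp.
rewrite -[RHS]coact1 -sub_coactE tmap_comp; congr (tunitr _); exact: eq_tmap.
Qed.

Definition subcomod_comodule : comodule C := Comodule sub_coactA sub_coact1.

Lemma subcomod_incl_coact x :
  coact (vsub_incl A x) = tmap (vsub_incl A) (lin_id C) (@coact K C subcomod_comodule x).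
Proof. by rewrite sub_coactE. Qed.

Definition subcomod_incl : comod_hom subcomod_comodule M :=
  @ComodHom K C subcomod_comodule M (vsub_incl A) subcomod_incl_coact.
End Structure.
End Subcomodule.
Coercion subcomod_comodule : subcomodule >-> comodule.

Section Notions.
Context (K : fieldType) (C : coalgebra K).
Implicit Types M N E F : comodule C.

Definition vsub_zero (U : lmodType K) (A : vsub U) := forall x, A x -> x = 0.
Definition vsub_full (U : lmodType K) (A : vsub U) := forall x, A x.

Definition direct_sum2 (U : lmodType K) (A B : vsub U) :=
  (forall x, exists a b, [/\ A a, B b & x = a + b]) /\
  (forall x, A x -> B x -> x = 0).

Definition simple M := (exists x : M, x <> 0) /\
  forall A : subcomodule M, vsub_zero A \/ vsub_full A.

Definition indecomposable M := (exists x : M, x <> 0) /\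
  forall A B : subcomodule M, direct_sum2 A B -> vsub_zero A \/ vsub_zero B.

Definition injective_comod E := forall M N (i : comod_hom M N) (f : comod_hom M E),
  injective i -> exists g : comod_hom N E, forall x, g (i x) = f x.

(* E is an injective envelope of M; the last clause says that the image of j is
   essential in E. *)
Definition injective_envelope M E := injective_comod E /\
  exists j : comod_hom M E, injective j /\
    forall A : subcomodule E, (forall x, A (j x) -> x = 0) -> vsub_zero A.

Definition fin_dim (U : lmodType K) := exists (n : nat) (s : 'I_n -> U),
  forall x : U, exists a : 'I_n -> K, x = \sum_(i < n) a i *: s i.

Definition fin_dim_hom F M := exists (n : nat) (h : 'I_n -> comod_hom F M),
  forall f : comod_hom F M, exists a : 'I_n -> K,
    forall x, f x = \sum_(i < n) a i *: h i x.

Definition quasi_finite M := forall F, fin_dim F -> fin_dim_hom F M.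

Section Socle.
Context (M : comodule C).

Definition socle_mem (x : M) := exists s : seq M, x = \sum_(y <- s) y /\
  forall y, y \in s -> exists A : subcomodule M, simple A /\ A y.

Lemma socle0 : socle_mem 0.
Proof. by exists [::]; rewrite big_nil. Qed.

Lemma socleL a x y : socle_mem x -> socle_mem y -> socle_mem (a *: x + y).
Proof.
move=> [s [-> sP]] [t [-> tP]]; exists ([seq a *: z | z <- s] ++ t).
rewrite big_cat big_map scaler_sumr; split=> // z; rewrite mem_cat.
case/orP=> [/mapP[w /sP[A [As Aw]] ->]|/tP//]; exists A; split=> //.
by have := vsubL a Aw (vsub0 A); rewrite addr0.
Qed.

Definition socle_vsub : vsub M := VSub socle0 socleL.

Lemma socle_is_subcomodule : is_subcomodule socle_vsub.
Proof.
move=> x [s [-> sP]].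
elim: s sP => [|y s IHs] sP.
  by exists 0; rewrite big_nil !linear0.
have [t tE] : exists t, tmap (vsub_incl socle_vsub) (lin_id C) t =
    coact (\sum_(y <- s) y).
  by apply: IHs => z zs; apply: sP; rewrite inE zs orbT.
have [A [As Ay]] := sP y (mem_head _ _).
have AS z : A z -> socle_vsub z.
  move=> Az; exists [:: z]; rewrite big_seq1; split=> // w.
  by rewrite inE => /eqP->; exists A.
have kL : linear (fun z : vsub_type A => vsub_in (AS _ (vsub_valP z))).
  by move=> a z w; apply: val_inj.
have [u uE] := subcomodP Ay.
exists (tmap (lin_of kL) (lin_id C) u + t).
rewrite big_cons linearD tE linearD -uE tmap_comp; congr (_ + _).
exact: eq_tmap.
Qed.

Definition socle : subcomodule M := Subcomodule socle_is_subcomodule.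
End Socle.
End Notions.

Definition convol (K : fieldType) (C : coalgebra K) (f g : {linear C -> K^o}) :
  {linear C -> K^o} := tunitl \o tmap f g \o comul.

Record dual_idempotent (K : fieldType) (C : coalgebra K) := DualIdempotent {
  idem_form :> {linear C -> K^o};
  idemP : forall c, convol idem_form idem_form c = idem_form c }.

Section Action.
Context (K : fieldType) (C : coalgebra K) (e : {linear C -> K^o}).

(* em = m_(0) e(m_(1)) *)
Definition eact (M : comodule C) : {linear M -> M} :=
  tunitr \o tmap (lin_id M) e \o coact.

(* ec = c_(1) e(c_(2)) *)
Definition lact : {linear C -> C} := eact (regular C).

(* ce = e(c_(1)) c_(2) *)
Definition ract : {linear C -> C} := tunitl \o tmap e (lin_id C) \o comul.

Lemma eactE (M : comodule C) (m : M) :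
  eact M m = tunitr (tmap (lin_id M) e (coact m)).
Proof. by []. Qed.

Lemma lactE c : lact c = tunitr (tmap (lin_id C) e (comul c)).
Proof. by []. Qed.

Lemma ractE c : ract c = tunitl (tmap e (lin_id C) (comul c)).
Proof. by []. Qed.

Lemma coact_eact (M : comodule C) (m : M) :
  coact (eact M m) = tmap (lin_id M) lact (coact m).
Proof.
rewrite eactE tunitr_nat tmap_comp.
rewrite (eq_tmap (f' := lin_id _ \o coact) (g' := e \o lin_id C)) // -tmap_comp.
rewrite tunitr_assoc coactA tmap_comp; exact: eq_tmap.
Qed.

Lemma comul_lact c : comul (lact c) = tmap (lin_id C) lact (comul c).
Proof. exact: (coact_eact (M := regular C)). Qed.

Lemma comul_ract c : comul (ract c) = tmap ract (lin_id C) (comul c).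
Proof.
rewrite ractE tunitl_nat tmap_comp.
rewrite (eq_tmap (f' := e \o lin_id C) (g' := lin_id _ \o comul)) // -tmap_comp.
by rewrite -comulA tunitl_assoc tmap_comp; exact: eq_tmap.
Qed.

Lemma lact_ract c : lact (ract c) = ract (lact c).
Proof.
rewrite lactE comul_ract tmap_comp lactE.
by rewrite tunitr_nat tmap_comp; congr (tunitr _); exact: eq_tmap.
Qed.

(* c |-> ece *)
Definition corner_proj : {linear C -> C} := lact \o ract.

Lemma corner_projE c : corner_proj c = lact (ract c).
Proof. by []. Qed.
End Action.

Section Idempotent.
Context (K : fieldType) (C : coalgebra K) (e : dual_idempotent C).

Lemma idem_lact c : e (lact e c) = e c.
Proof.
rewrite -[RHS]idemP lactE [RHS]tunitlr tunitr_nat tmap_comp.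
by congr (tunitr _); exact: eq_tmap.
Qed.

Lemma idem_ract c : e (ract e c) = e c.
Proof.
rewrite -[RHS]idemP ractE tunitl_nat tmap_comp.
by congr (tunitl _); exact: eq_tmap.
Qed.

Lemma eact_eact (M : comodule C) (m : M) : eact e M (eact e M m) = eact e M m.
Proof.
rewrite eactE coact_eact tmap_comp eactE; congr (tunitr _).
by apply: eq_tmap => // c; rewrite /= idem_lact.
Qed.

Lemma lact_lact c : lact e (lact e c) = lact e c.
Proof. exact: (eact_eact (M := regular C)). Qed.

Lemma ract_ract c : ract e (ract e c) = ract e c.
Proof.
rewrite ractE comul_ract tmap_comp ractE; congr (tunitl _).
by apply: eq_tmap => // c'; rewrite /= idem_ract.
Qed.

(* eCe *)
Definition corner_vsub : vsub C := lin_image (corner_proj e).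

Definition to_corner : {linear C -> vsub_type corner_vsub} :=
  to_image (corner_proj e).

Lemma to_corner_lact c : to_corner (lact e c) = to_corner c.
Proof. by apply: vsub_incl_inj; rewrite !to_imageE !corner_projE -lact_ract lact_lact. Qed.

Lemma to_corner_ract c : to_corner (ract e c) = to_corner c.
Proof. by apply: vsub_incl_inj; rewrite !to_imageE !corner_projE ract_ract. Qed.

Definition corner_comul : {linear vsub_type corner_vsub ->
    tens (vsub_type corner_vsub) (vsub_type corner_vsub)} :=
  tmap to_corner to_corner \o comul \o vsub_incl corner_vsub.

Definition corner_counit : {linear vsub_type corner_vsub -> K^o} :=
  counit \o vsub_incl corner_vsub.

(* Delta(ece) = e c_(1) e (x) e c_(2) e *)
Lemma corner_comulE c :
  corner_comul (to_corner c) = tmap to_corner to_corner (comul c).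
Proof.
transitivity (tmap to_corner to_corner (comul (lact e (ract e c)))) => //.
rewrite comul_lact comul_ract !tmap_comp; apply: eq_tmap => c'.
- exact: to_corner_ract.
- exact: to_corner_lact.
Qed.

Lemma counit_lact c : counit (lact e c) = e c.
Proof.
rewrite lactE tunitr_nat tmap_comp -[in RHS](counitl c).
by rewrite tunitl_nat tmap_comp tunitlr; congr (tunitr _); exact: eq_tmap.
Qed.

Lemma corner_counitE c : corner_counit (to_corner c) = e c.
Proof. by rewrite -(idem_ract c) -counit_lact. Qed.

Lemma corner_comulA c :
  tassoc (tmap corner_comul (lin_id _) (corner_comul c)) =
  tmap (lin_id _) corner_comul (corner_comul c).
Proof.
have [x <-] := to_image_surj c; rewrite corner_comulE !tmap_comp.
transitivity (tassoc (tmap (tmap to_corner to_corner) to_corner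
    (tmap comul (lin_id _) (comul x)))).
  congr (tassoc _); rewrite tmap_comp; apply: eq_tmap => // y.
  exact: corner_comulE.
rewrite tassoc_nat comulA tmap_comp; apply: eq_tmap => // y.
by rewrite [RHS]corner_comulE.
Qed.

Lemma corner_counitl c : tunitl (tmap corner_counit (lin_id _) (corner_comul c)) = c.
Proof.
have [x <-] := to_image_surj c; rewrite corner_comulE !tmap_comp.
rewrite -[RHS]to_corner_ract ractE tunitl_nat tmap_comp; congr (tunitl _).
by apply: eq_tmap => // y; exact: corner_counitE.
Qed.

Lemma corner_counitr c : tunitr (tmap (lin_id _) corner_counit (corner_comul c)) = c.
Proof.
have [x <-] := to_image_surj c; rewrite corner_comulE !tmap_comp.
rewrite -[RHS]to_corner_lact lactE tunitr_nat tmap_comp; congr (tunitr _).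
by apply: eq_tmap => // y; exact: corner_counitE.
Qed.

Definition corner : coalgebra K :=
  Coalgebra corner_comulA corner_counitl corner_counitr.

Section Quotient.
Context (M : comodule C).

(* eM *)
Definition quot_vsub : vsub M := lin_image (eact e M).

Definition to_quot : {linear M -> vsub_type quot_vsub} := to_image (eact e M).

Definition quot_coact : {linear vsub_type quot_vsub ->
    tens (vsub_type quot_vsub) corner} :=
  tmap to_quot to_corner \o coact \o vsub_incl quot_vsub.

(* em |-> e m_(0) (x) e m_(1) e *)
Lemma quot_coactE m : quot_coact (to_quot m) = tmap to_quot to_corner (coact m).
Proof.
transitivity (tmap to_quot to_corner (coact (eact e M m))) => //.
rewrite coact_eact tmap_comp; apply: eq_tmap => // c.
exact: to_corner_lact.
Qed.

Lemma quot_coactA m : tassoc (tmap quot_coact (lin_id _) (quot_coact m)) =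
  tmap (lin_id _) comul (quot_coact m).
Proof.
have [x <-] := to_image_surj m; rewrite quot_coactE !tmap_comp.
transitivity (tassoc (tmap (tmap to_quot to_corner) to_corner
    (tmap coact (lin_id _) (coact x)))).
  congr (tassoc _); rewrite tmap_comp; apply: eq_tmap => // y.
  exact: quot_coactE.
rewrite tassoc_nat coactA tmap_comp; apply: eq_tmap => // y.
by rewrite [RHS]corner_comulE.
Qed.

Lemma quot_coact1 m : tunitr (tmap (lin_id _) counit (quot_coact m)) = m.
Proof.
have [x <-] := to_image_surj m; rewrite quot_coactE tmap_comp.
have -> : to_image (eact e M) x = to_quot (eact e M x).
  by apply: vsub_incl_inj; rewrite !to_imageE eact_eact.
rewrite eactE tunitr_nat tmap_comp; congr (tunitr _).
by apply: eq_tmap => // y; exact: corner_counitE.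
Qed.

Definition quotient_functor : comodule corner := Comodule quot_coactA quot_coact1.
End Quotient.
End Idempotent.

Record bicomodule (K : fieldType) (D C : coalgebra K) := Bicomodule {
  bicomod_space :> lmodType K;
  lcoact : {linear bicomod_space -> tens D bicomod_space};
  rcoact : {linear bicomod_space -> tens bicomod_space C};
  lcoactA : forall p,
    tassoc (tmap comul (lin_id _) (lcoact p)) = tmap (lin_id _) lcoact (lcoact p);
  lcoact1 : forall p, tunitl (tmap counit (lin_id _) (lcoact p)) = p;
  rcoactA : forall p,
    tassoc (tmap rcoact (lin_id _) (rcoact p)) = tmap (lin_id _) comul (rcoact p);
  rcoact1 : forall p, tunitr (tmap (lin_id _) counit (rcoact p)) = p;
  lrcoact : forall p,
    tassoc (tmap lcoact (lin_id _) (rcoact p)) = tmap (lin_id _) rcoact (lcoact p) }.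

Arguments lcoact {K D C P} : rename.
Arguments rcoact {K D C P} : rename.

Section Ce.
Context (K : fieldType) (C : coalgebra K) (e : dual_idempotent C).

Definition Ce_vsub : vsub C := lin_image (ract e).

Definition to_Ce : {linear C -> vsub_type Ce_vsub} := to_image (ract e).

Lemma to_Ce_ract c : to_Ce (ract e c) = to_Ce c.
Proof. by apply: vsub_incl_inj; rewrite !to_imageE ract_ract. Qed.

Definition Ce_lcoact : {linear vsub_type Ce_vsub ->
    tens (corner e) (vsub_type Ce_vsub)} :=
  tmap (to_corner e) to_Ce \o comul \o vsub_incl Ce_vsub.

Definition Ce_rcoact : {linear vsub_type Ce_vsub -> tens (vsub_type Ce_vsub) C} :=
  tmap to_Ce (lin_id C) \o comul \o vsub_incl Ce_vsub.

(* ce |-> e c_(1) e (x) c_(2) e *)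
Lemma Ce_lcoactE c : Ce_lcoact (to_Ce c) = tmap (to_corner e) to_Ce (comul c).
Proof.
transitivity (tmap (to_corner e) to_Ce (comul (ract e c))) => //.
rewrite comul_ract tmap_comp; apply: eq_tmap => // x.
exact: to_corner_ract.
Qed.

(* ce |-> c_(1) e (x) c_(2) *)
Lemma Ce_rcoactE c : Ce_rcoact (to_Ce c) = tmap to_Ce (lin_id C) (comul c).
Proof.
transitivity (tmap to_Ce (lin_id C) (comul (ract e c))) => //.
rewrite comul_ract tmap_comp; apply: eq_tmap => // x.
exact: to_Ce_ract.
Qed.

Lemma Ce_lcoactA p : tassoc (tmap comul (lin_id _) (Ce_lcoact p)) =
  tmap (lin_id _) Ce_lcoact (Ce_lcoact p).
Proof.
have [x <-] := to_image_surj p; rewrite Ce_lcoactE !tmap_comp.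
transitivity (tassoc (tmap (tmap (to_corner e) (to_corner e)) to_Ce
    (tmap comul (lin_id _) (comul x)))).
  congr (tassoc _); rewrite tmap_comp; apply: eq_tmap => // y.
  exact: corner_comulE.
rewrite tassoc_nat comulA tmap_comp; apply: eq_tmap => // y.
by rewrite [RHS]Ce_lcoactE.
Qed.

Lemma Ce_lcoact1 p : tunitl (tmap counit (lin_id _) (Ce_lcoact p)) = p.
Proof.
have [x <-] := to_image_surj p; rewrite Ce_lcoactE !tmap_comp.
rewrite -[RHS]to_Ce_ract ractE tunitl_nat tmap_comp; congr (tunitl _).
by apply: eq_tmap => // y; exact: corner_counitE.
Qed.

Lemma Ce_rcoactA p : tassoc (tmap Ce_rcoact (lin_id _) (Ce_rcoact p)) =
  tmap (lin_id _) comul (Ce_rcoact p).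
Proof.
have [x <-] := to_image_surj p; rewrite Ce_rcoactE !tmap_comp.
transitivity (tassoc (tmap (tmap to_Ce (lin_id C)) (lin_id C)
    (tmap comul (lin_id _) (comul x)))).
  congr (tassoc _); rewrite tmap_comp; apply: eq_tmap => // y.
  exact: Ce_rcoactE.
by rewrite tassoc_natl comulA tmap_comp; exact: eq_tmap.
Qed.

Lemma Ce_rcoact1 p : tunitr (tmap (lin_id _) counit (Ce_rcoact p)) = p.
Proof.
have [x <-] := to_image_surj p; rewrite Ce_rcoactE !tmap_comp.
rewrite -[in RHS](counitr x) tunitr_nat tmap_comp; congr (tunitr _).
exact: eq_tmap.
Qed.

Lemma Ce_lrcoact p : tassoc (tmap Ce_lcoact (lin_id _) (Ce_rcoact p)) =
  tmap (lin_id _) Ce_rcoact (Ce_lcoact p).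
Proof.
have [x <-] := to_image_surj p; rewrite Ce_rcoactE Ce_lcoactE !tmap_comp.
transitivity (tassoc (tmap (tmap (to_corner e) to_Ce) (lin_id C)
    (tmap comul (lin_id _) (comul x)))).
  congr (tassoc _); rewrite tmap_comp; apply: eq_tmap => // y.
  exact: Ce_lcoactE.
rewrite tassoc_nat comulA tmap_comp; apply: eq_tmap => // y.
by rewrite [RHS]Ce_rcoactE.
Qed.

Definition Ce : bicomodule (corner e) C :=
  Bicomodule Ce_lcoactA Ce_lcoact1 Ce_rcoactA Ce_rcoact1 Ce_lrcoact.
End Ce.

Section Cotensor.
Context (K : fieldType) (D C : coalgebra K) (P : bicomodule D C).

Section Object.
Context (N : comodule D).

Definition tens_coact : {linear tens N P -> tens (tens N P) C} :=
  tassocV \o tmap (lin_id N) rcoact.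

Lemma tens_coactA x : tassoc (tmap tens_coact (lin_id _) (tens_coact x)) =
  tmap (lin_id _) comul (tens_coact x).
Proof.
transitivity (tassoc (tmap tassocV (lin_id C) (tassocV
    (tmap (lin_id N) (tmap rcoact (lin_id C)) (tmap (lin_id N) rcoact x))))).
  by congr (tassoc _); rewrite tassocV_nat [RHS]tmap_comp; exact: eq_tmap.
rewrite pentagonV -[RHS]tassocV_natr !tmap_comp; congr (tassocV _).
by apply: eq_tmap => // p; exact: rcoactA.
Qed.

Lemma tens_coact1 x : tunitr (tmap (lin_id _) counit (tens_coact x)) = x.
Proof.
rewrite -tassocV_natr tunitr_tassocV !tmap_comp.
by apply: tmap_id => // p; exact: rcoact1.
Qed.

Definition tens_comodule : comodule C := Comodule tens_coactA tens_coact1.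

Definition cotensor_diff : {linear tens N P -> tens N (tens D P)} :=
  (tassoc \o tmap coact (lin_id P)) \- tmap (lin_id N) lcoact.

Lemma cotensor_diff_coact x : exists G : {linear tens N (tens D P) ->
  tens (tens N (tens D P)) C},
  tmap cotensor_diff (lin_id C) (tens_coact x) = G (cotensor_diff x).
Proof.
pose F1 : {linear tens N P -> _} := tassoc \o tmap coact (lin_id P).
pose F2 : {linear tens N P -> _} := tmap (lin_id N) lcoact.
pose G : {linear tens N (tens D P) -> tens (tens N (tens D P)) C} :=
  tassocV \o tmap (lin_id N) (tassocV \o tmap (lin_id D) rcoact).
exists G.
have E (t : tens (tens N P) C) : tmap cotensor_diff (lin_id C) t =
    tmap F1 (lin_id C) t - tmap F2 (lin_id C) t.
  elim/(@tens_ind K (tens N P) C): t => [|y c|y z IHy IHz].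
  - by rewrite !linear0 ?subr0 ?addr0.
  - apply/eqP; rewrite !tmapE eq_sym subr_eq -pureDl; apply/eqP.
    by congr pure; rewrite [cotensor_diff _]/(F1 y - F2 y) subrK.
  - by rewrite !linearD IHy IHz addrACA.
rewrite E [cotensor_diff x]/(F1 x - F2 x) linearB; congr (_ - _).
- transitivity (tmap tassoc (lin_id C) (tmap (tmap coact (lin_id P)) (lin_id C)
    (tens_coact x))).
    by rewrite tmap_comp; exact: eq_tmap.
  rewrite -tassocV_natl pentagon; congr (tassocV _).
  transitivity (tmap (lin_id N) tassocV (tmap (lin_id N) (tmap (lin_id D) rcoact)
    (F1 x))); last by rewrite tmap_comp; exact: eq_tmap.
  congr (tmap _ _ _); rewrite -tassoc_nat !tmap_comp; congr (tassoc _).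
  by apply: eq_tmap => // y; rewrite [RHS]tmap_id.
- transitivity (tassocV (tmap (lin_id N) (tmap lcoact (lin_id C))
    (tmap (lin_id N) rcoact x))); first by rewrite tassocV_nat.
  congr (tassocV _); rewrite !tmap_comp; apply: eq_tmap => // p.
  by apply: (can_inj (@tassocK _ _ _ _)); rewrite [RHS]tassocVK; exact: lrcoact.
Qed.

(* N [] P, the equalizer of rho (x) 1 and 1 (x) lambda *)
Definition cotensor_vsub : vsub (tens_comodule) := lin_ker cotensor_diff.

Lemma cotensor_is_subcomodule : is_subcomodule cotensor_vsub.
Proof.
move=> x dx; apply: tmap_ker.
by have [G ->] := cotensor_diff_coact x; rewrite dx linear0.
Qed.

Definition cotensor : subcomodule tens_comodule :=
  Subcomodule cotensor_is_subcomodule.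
End Object.

Section Morphism.
Context (N N' : comodule D) (f : comod_hom N N').

Lemma cotensor_map_mem (x : vsub_type (cotensor N)) :
  cotensor N' (tmap f (lin_id P) (vsub_incl _ x)).
Proof.
have /eqP := vsub_valP x; rewrite subr_eq0 => /eqP /= xE.
apply/eqP; rewrite subr_eq0; apply/eqP => /=.
transitivity (tmap f (lin_id _) (tassoc (tmap coact (lin_id P) (vsub_val x)))).
  rewrite -tassoc_natl !tmap_comp; congr (tassoc _).
  by apply: eq_tmap => // n; exact: hom_coact.
by rewrite xE !tmap_comp; exact: eq_tmap.
Qed.

Lemma cotensor_map_linear : linear (fun x => vsub_in (cotensor_map_mem x)).
Proof. by move=> a x y; apply: vsub_incl_inj; rewrite /= linearP. Qed.

Lemma cotensor_map_coact (x : cotensor N) :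
  @coact K C (cotensor N') (lin_of cotensor_map_linear x) =
  tmap (lin_of cotensor_map_linear) (lin_id C) (@coact K C (cotensor N) x).
Proof.
apply: (@tmap_incl_inj K _ _ (cotensor N')).
rewrite [LHS]sub_coactE [RHS]tmap_comp.
transitivity (tmap (tmap f (lin_id P)) (lin_id C)
  (tmap (vsub_incl (cotensor N)) (lin_id C) (@coact K C (cotensor N) x))).
  rewrite [X in _ = tmap _ _ X]sub_coactE /= -tassocV_nat !tmap_comp.
  by congr (tassocV _); apply: eq_tmap => // p /=; rewrite tmap_id.
by rewrite tmap_comp; exact: eq_tmap.
Qed.

Definition cotensor_map : comod_hom (cotensor N) (cotensor N') :=
  ComodHom cotensor_map_coact.
End Morphism.
End Cotensor.

Section SectionFunctor.
Context (K : fieldType) (C : coalgebra K) (e : dual_idempotent C).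

Definition section_functor (N : comodule (corner e)) : comodule C :=
  cotensor (Ce e) N.

Definition section_map (N N' : comodule (corner e)) (f : comod_hom N N') :
  comod_hom (section_functor N) (section_functor N') := cotensor_map (Ce e) f.

Definition torsion (M : comodule C) := forall x : quotient_functor e M, x = 0.

Definition torsion_free (M : comodule C) :=
  forall A : subcomodule M, torsion A -> vsub_zero A.
End SectionFunctor.

Section Standing.
Context (K : fieldType) (C : coalgebra K).

(* S is the internal direct sum of the family A. *)
Definition direct_sum (U : lmodType K) (J : Type) (A : J -> vsub U) (S : vsub U) :=
  (forall x, S x <-> exists (n : nat) (g : 'I_n -> J) (y : 'I_n -> U),
     (forall i, A (g i) (y i)) /\ x = \sum_(i < n) y i) /\
  (forall (n : nat) (g : 'I_n -> J) (y : 'I_n -> U), injective g ->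
     (forall i, A (g i) (y i)) -> \sum_(i < n) y i = 0 -> forall i, y i = 0).

Definition basic := exists (J : Type) (A : J -> subcomodule (regular C)),
  [/\ forall j, simple (A j), forall i j, comod_iso (A i) (A j) -> i = j &
      direct_sum A (socle (regular C))].

Definition is_subcoalgebra (A : vsub C) := forall c, A c ->
  exists t : tens (vsub_type A) (vsub_type A),
    tmap (vsub_incl A) (vsub_incl A) t = comul c.

Definition indecomposable_coalgebra := (exists c : C, c <> 0) /\
  forall A B : vsub C, is_subcoalgebra A -> is_subcoalgebra B ->
    direct_sum2 A B -> vsub_zero A \/ vsub_zero B.

Definition complete_simples (I : Type) (S : I -> comodule C) :=
  [/\ forall x, simple (S x), forall x y, comod_iso (S x) (S y) -> x = y &
      forall M : comodule C, simple M -> exists x, comod_iso M (S x)].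

(* x lies in I_e, that is, T(S_x) is non-zero. *)
Definition index_in (e : dual_idempotent C) (I : Type) (S : I -> comodule C) (x : I) :=
  exists y : quotient_functor e (S x), y <> 0.
End Standing.

Arguments basic {K} C.
Arguments indecomposable_coalgebra {K} C.

(* Main.v *)
(* Morphisms TM -> N correspond to the linear maps M -> N compatible with the
   coactions along C -> eCe, and composing with the evaluation
   ev : S(N) -> N, n (x) ce |-> e(c) n, identifies Hom(M, S(N)) with these maps:
   this is the adjunction between T and S.  Since ev is onto and x in S(N) with
   ev x = 0 satisfies e x = 0, subcomodules A and B of S(N) with zero
   intersection have images under ev with zero intersection, and A = 0 as soon as
   ev(A) = 0.  Indecomposability, the socle and the essentiality of S_x in
   S(Ebar_x) are read off from these two facts, and the rest is formal. *)
Require Import Defs.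
From mathcomp Require Import all_boot all_order all_algebra.
From mathcomp Require Import boolp.

Set Implicit Arguments.
Unset Strict Implicit.
Unset Printing Implicit Defensive.

Import GRing.Theory.
Local Open Scope ring_scope.

(** * Subspaces, kernels and tensor products *)

Section LinearAlgebra.
Context (K : fieldType).
Implicit Types U V W : lmodType K.

Lemma tmap_incl_sub U W (A B : vsub U) (t : tens (vsub_type A) W) :
  (forall x, A x -> B x) ->
  exists t', tmap (vsub_incl B) (lin_id W) t' = tmap (vsub_incl A) (lin_id W) t.
Proof.
move=> AB.
have kL : linear (fun z : vsub_type A => vsub_in (AB _ (vsub_valP z))).
  by move=> a z w; apply: val_inj.
exists (tmap (lin_of kL) (lin_id W) t); rewrite tmap_comp; exact: eq_tmap.
Qed.

(** Subtracting from the identity a projection onto A turns membership in A into an equation, to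
    which the exactness result [tmap_ker] applies. *)
Lemma vsub_kernel U (A : vsub U) :
  exists p : {linear U -> U}, forall x, p x = 0 <-> A x.
Proof.
pose k : {linear U -> U} := vsub_incl A \o retraction A.
have pL : linear (fun x => x - k x).
  by move=> a x y; rewrite linearP scalerBr opprD addrACA.
exists (lin_of pL) => x; rewrite lin_ofE; split=> [/eqP|Ax].
  by rewrite subr_eq0 => /eqP ->; exact: vsub_valP.
apply/eqP; rewrite subr_eq0; apply/eqP.
by rewrite [k x](congr1 (vsub_incl A) (retractionK (vsub_in Ax))).
Qed.
End LinearAlgebra.

(** * Subcomodules, morphisms and injective envelopes *)

Section Comodules.
Context (K : fieldType) (C : coalgebra K).
Implicit Types M N E : comodule C.

(** The general g covers both morphisms of comodules, where it is the identity, and maps from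
    C-comodules to eCe-comodules, where it is c |-> ece. *)
Lemma lin_image_is_subcomodule (D : coalgebra K) M (N : comodule D)
    (f : {linear M -> N}) (g : {linear C -> D}) :
  (forall m, coact (f m) = tmap f g (coact m)) -> is_subcomodule (lin_image f).
Proof.
move=> fg x [m <-]; exists (tmap (to_image f) g (coact m)).
by rewrite tmap_comp fg; exact: eq_tmap.
Qed.

Lemma hom_image_is_subcomodule M N (f : comod_hom M N) :
  is_subcomodule (lin_image f).
Proof. exact: lin_image_is_subcomodule (@hom_coact _ _ _ _ f). Qed.

Definition hom_image M N (f : comod_hom M N) : subcomodule N :=
  Subcomodule (@hom_image_is_subcomodule _ _ f).

Lemma preimage_closed M N (f : comod_hom M N) (A : subcomodule N) a x y :
  A (f x) -> A (f y) -> A (f (a *: x + y)).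
Proof. by rewrite linearP; apply: vsubL. Qed.

Lemma preimage0 M N (f : comod_hom M N) (A : subcomodule N) : A (f 0).
Proof. by rewrite linear0; apply: vsub0. Qed.

Definition preimage_vsub M N (f : comod_hom M N) (A : subcomodule N) : vsub M :=
  VSub (preimage0 f A) (preimage_closed (f := f) (A := A)).

(** If p has kernel A, the preimage is the kernel of pf. Since f x coacts inside A (x) C, the map pf
    (x) 1 kills the coaction of x, and exactness of the tensor product concludes. *)
Lemma preimage_is_subcomodule M N (f : comod_hom M N) (A : subcomodule N) :
  is_subcomodule (preimage_vsub f A).
Proof.
move=> x /= Afx; have [p pE] := vsub_kernel A.
have [t <-] : exists t, tmap (vsub_incl (lin_ker (p \o f))) (lin_id C) t = coact x.
  apply: tmap_ker; have [t tE] := subcomodP Afx.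
  transitivity (tmap p (lin_id C) (tmap f (lin_id C) (coact x))).
    by rewrite tmap_comp; exact: eq_tmap.
  rewrite -hom_coact -tE tmap_comp; move: t {tE}; apply: (tens_ext (g := \0)).
  move=> a c; rewrite tmapE /= (_ : p (vsub_val a) = 0) ?pure0l //.
  by apply/pE; exact: vsub_valP.
by apply: tmap_incl_sub => y /= /pE.
Qed.

Definition preimage M N (f : comod_hom M N) (A : subcomodule N) : subcomodule M :=
  Subcomodule (@preimage_is_subcomodule _ _ f A).

Lemma ker_is_subcomodule M N (f : comod_hom M N) : is_subcomodule (lin_ker f).
Proof. by move=> x /= fx; apply: tmap_ker; rewrite -hom_coact fx linear0. Qed.

Definition hom_ker M N (f : comod_hom M N) : subcomodule M :=
  Subcomodule (@ker_is_subcomodule _ _ f).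

Lemma hom_ker_zero M N (f : comod_hom M N) : vsub_zero (hom_ker f) -> injective f.
Proof.
move=> f0 x y fxy; apply/eqP; rewrite -subr_eq0; apply/eqP/f0.
by rewrite /= linearB fxy subrr.
Qed.

Section Corestriction.
Context M N (f : comod_hom M N) (A : subcomodule N) (fA : forall m, A (f m)).

Lemma hom_corestr_linear : linear (fun m => vsub_in (fA m)).
Proof. by move=> a x y; apply: vsub_incl_inj; rewrite /= linearP. Qed.

Lemma hom_corestr_coact m : @coact K C A (lin_of hom_corestr_linear m) =
  tmap (lin_of hom_corestr_linear) (lin_id C) (coact m).
Proof.
apply: (@tmap_incl_inj K N C A); rewrite sub_coactE [RHS]tmap_comp.
rewrite [LHS](hom_coact f); exact: eq_tmap.
Qed.

Definition hom_corestr : comod_hom M A := ComodHom hom_corestr_coact.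
End Corestriction.

Lemma bij_comod_iso M N (f : comod_hom M N) :
  injective f -> (forall y, exists x, f x = y) -> comod_iso M N.
Proof.
move=> fI /choice[g fK].
have gK : cancel f g by move=> x; apply: fI; rewrite fK.
have gL : linear g by move=> a x y; apply: fI; rewrite linearP !fK.
have gC y : coact (lin_of gL y) = tmap (lin_of gL) (lin_id C) (coact y).
  rewrite -{2}(fK y) hom_coact tmap_comp; symmetry; exact: tmap_id.
by exists f, (ComodHom gC).
Qed.

Lemma comod_iso_sym M N : comod_iso M N -> comod_iso N M.
Proof. by move=> [f [g [fK gK]]]; exists g, f. Qed.

Lemma hom_lincomb2 M N (a : K) (f g : comod_hom M N) :
  exists h : comod_hom M N, forall x, h x = a *: f x + g x.
Proof.
have hL : linear (fun x => a *: f x + g x).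
  move=> b x y; rewrite (linearP f) (linearP g) !scalerDr !scalerA.
  by rewrite [a * b]mulrC addrACA.
suff hC x : coact (lin_of hL x) = tmap (lin_of hL) (lin_id C) (coact x).
  by exists (ComodHom hC).
rewrite /= linearP !hom_coact; elim/(@tens_ind K M C): (coact x) => [|m c|t u IHt IHu].
- by rewrite !linear0 addr0.
- by rewrite !tmapE pureDl pureZl.
- by rewrite !linearD -IHt -IHu addrACA.
Qed.

Lemma hom_zero M N : exists h : comod_hom M N, forall x, h x = 0.
Proof.
have hC x : coact (\0 x : N) = tmap (\0 : {linear M -> N}) (lin_id C) (coact x).
  rewrite linear0; symmetry; move: (coact x); apply: (tens_ext (g := \0)) => m c.
  by rewrite tmapE pure0l.
by exists (ComodHom hC).
Qed.

(** Turns a linear combination of morphisms into a [comod_hom], so that [section_ev_ext] applies to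
    it in the proof of quasi-finiteness. *)
Lemma hom_lincomb M N n (a : 'I_n -> K) (f : 'I_n -> comod_hom M N) :
  exists h : comod_hom M N, forall x, h x = \sum_(i < n) a i *: f i x.
Proof.
elim: n a f => [|n IHn] a f.
  by have [h hE] := hom_zero M N; exists h => x; rewrite big_ord0.
have [g gE] := IHn (fun i => a (lift ord0 i)) (fun i => f (lift ord0 i)).
have [h hE] := hom_lincomb2 (a ord0) (f ord0) g.
by exists h => x; rewrite hE gE big_ord_recl.
Qed.

Lemma simple_hom_inj M N (f : comod_hom M N) :
  simple M -> (exists x, f x <> 0) -> injective f.
Proof.
move=> [_ Msub] [x fx]; have [/hom_ker_zero //|kT] := Msub (hom_ker f).
by have := kT x.
Qed.

Lemma simple_image M N (f : comod_hom M N) :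
  simple M -> (forall y, exists x, f x = y) -> (exists y : N, y <> 0) -> simple N.
Proof.
move=> [_ Msub] f_surj N0; split=> // A.
have [A0|AT] := Msub (preimage f A).
  left=> y; have [x <-] := f_surj y => /= Afx; by rewrite (A0 x Afx) linear0.
by right=> y; have [x <-] := f_surj y; exact: AT.
Qed.

(** Extend j2 along j1 to g : E1 -> E2. Its kernel misses the image of j1, so g is injective and has
    a retraction h. As h j2 = j1, the kernel of h misses the image of j2, so h is injective as well
    as onto. *)
Lemma injective_envelope_unique M E1 E2 :
  injective_envelope M E1 -> injective_envelope M E2 -> comod_iso E1 E2.
Proof.
move=> [E1I [j1 [j1I j1E]]] [E2I [j2 [j2I j2E]]].
have [g gj] := E2I _ _ j1 j2 j1I.
have gI : injective g.
  apply/hom_ker_zero/j1E => x /=; rewrite gj => j20.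
  by apply: j2I; rewrite j20 linear0.
have [h hg] := E1I _ _ g (hom_id E1) gI.
have hI : injective h.
  apply/hom_ker_zero/j2E => x /=; rewrite -gj hg /= => j10.
  by apply: j1I; rewrite j10 linear0.
apply: comod_iso_sym; apply: (bij_comod_iso hI) => y.
by exists (g y); rewrite hg.
Qed.

(** * The action of the idempotent on comodules *)

Section IdempotentAction.
Context (e : dual_idempotent C).

Lemma hom_eact M N (f : comod_hom M N) m : f (eact e M m) = eact e N (f m).
Proof.
rewrite !eactE hom_coact tunitr_nat !tmap_comp; congr (tunitr _); exact: eq_tmap.
Qed.

Lemma subcomod_eact M (A : subcomodule M) x : A x -> A (eact e M x).
Proof.
move=> Ax; have -> : eact e M x = vsub_incl A (eact e A (vsub_in Ax)).
  by rewrite (hom_eact (subcomod_incl A)).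
exact: vsub_valP.
Qed.

Lemma to_quot_val M (y : quotient_functor e M) : to_quot e M (vsub_val y) = y.
Proof.
have [x <-] := to_image_surj y.
by apply: vsub_incl_inj; exact: eact_eact.
Qed.

Lemma eact_quot M (y : quotient_functor e M) : eact e M (vsub_val y) = vsub_val y.
Proof. exact: congr1 (to_quot_val y). Qed.

Lemma torsionP M : torsion e M <-> forall x : M, eact e M x = 0.
Proof.
split=> [h x|h y]; first exact: (congr1 (vsub_incl _) (h (to_quot e M x))).
by have [x <-] := to_image_surj y; apply: vsub_incl_inj; exact: h.
Qed.
End IdempotentAction.
End Comodules.

(** * The adjunction between quotient and section functors *)

Section Adjunction.
Context (K : fieldType) (C : coalgebra K) (e : dual_idempotent C).
Implicit Types (M : comodule C) (N : comodule (corner e)).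

(* These are the composites M -> eM -> N with a morphism of eCe-comodules
   eM -> N; invariance under M -> eM follows from the counit law of N. *)
Definition corner_colinear M N (f : {linear M -> N}) :=
  forall m, coact (f m) = tmap f (to_corner e) (coact m).

(** The counit of eCe takes ece to e(c), so the counit law of N at f m reads f(m_(0)) e(m_(1)) = f
    m. *)
Lemma corner_colinear_eact M N (f : {linear M -> N}) :
  corner_colinear f -> forall m, f (eact e M m) = f m.
Proof.
move=> fC m; rewrite -[RHS]coact1 fC tmap_comp eactE tunitr_nat tmap_comp.
congr (tunitr _); apply: eq_tmap => // c; exact/esym/corner_counitE.
Qed.

Lemma to_quot_colinear M : corner_colinear (N := quotient_functor e M) (to_quot e M).
Proof. by move=> m; exact: quot_coactE. Qed.

Lemma hom_comp_colinear M N N' (f : {linear M -> N}) (g : comod_hom N N') :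
  corner_colinear f -> corner_colinear (g \o f).
Proof. by move=> fC m; rewrite /= hom_coact fC tmap_comp; exact: eq_tmap. Qed.

Lemma colinear_comp_hom M M' N (f : {linear M' -> N}) (g : comod_hom M M') :
  corner_colinear f -> corner_colinear (f \o g).
Proof. by move=> fC m; rewrite /= fC hom_coact tmap_comp; exact: eq_tmap. Qed.

Section Descent.
Context M N (f : {linear M -> N}) (fC : corner_colinear f).

(** As f absorbs the action of e, restricting it to eM gives its factorization through m |-> em. *)
Definition descent_fun : {linear quotient_functor e M -> N} :=
  f \o vsub_incl (quot_vsub e M).

Lemma descent_coact y : coact (descent_fun y) =
  tmap descent_fun (lin_id (corner e)) (coact y).
Proof.
rewrite -(to_quot_val y) to_quot_colinear tmap_comp [LHS]fC.
rewrite coact_eact tmap_comp; apply: eq_tmap => [z|c].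
  exact/esym/corner_colinear_eact.
exact: to_corner_lact.
Qed.

Definition descent : comod_hom (quotient_functor e M) N := ComodHom descent_coact.

Lemma descentE m : descent (to_quot e M m) = f m.
Proof. exact: corner_colinear_eact. Qed.
End Descent.

Lemma counit_ract c : counit (ract e c) = e c.
Proof.
rewrite ractE tunitl_nat tmap_comp -[in RHS](counitr c).
by rewrite tunitr_nat tmap_comp -tunitlr; congr (tunitl _); exact: eq_tmap.
Qed.

(** The form ce |-> e(c), with which ev evaluates the second tensor factor. *)
Definition Ce_counit : {linear Ce e -> K^o} := counit \o vsub_incl (Ce_vsub e).

Lemma Ce_counitE c : Ce_counit (to_Ce e c) = e c.
Proof. exact: counit_ract. Qed.

Definition Ce_to_corner : {linear Ce e -> corner e} :=
  to_corner e \o vsub_incl (Ce_vsub e).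

Lemma Ce_lcoact_counit p :
  tunitr (tmap (lin_id (corner e)) Ce_counit (lcoact p)) = Ce_to_corner p.
Proof.
have [c <-] := to_image_surj p; rewrite [lcoact _]Ce_lcoactE tmap_comp.
rewrite [RHS]to_corner_ract -to_corner_lact lactE tunitr_nat tmap_comp.
by congr (tunitr _); apply: eq_tmap => // x; exact: Ce_counitE.
Qed.

Lemma Ce_rcoact_counit (W : lmodType K) (h : {linear C -> W}) p :
  tunitl (tmap Ce_counit h (rcoact p)) = h (vsub_incl (Ce_vsub e) p).
Proof.
have [c <-] := to_image_surj p; rewrite [rcoact _]Ce_rcoactE tmap_comp.
rewrite [RHS](tunitl_nat h) tmap_comp.
by congr (tunitl _); apply: eq_tmap => // x; exact: Ce_counitE.
Qed.

Definition tens_ev N : {linear tens N (Ce e) -> N} :=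
  tunitr \o tmap (lin_id N) Ce_counit.

(** Evaluating after the coaction of N (x) Ce only undoes the right coaction of Ce. It is used with
    h = [to_Ce] to recover x, and with h = [to_corner e] for the colinearity of ev. *)
Lemma tens_ev_coact N (W : lmodType K) (h : {linear C -> W}) x :
  tmap (tens_ev N) h (tens_coact (Ce e) N x) =
  tmap (lin_id N) (h \o vsub_incl (Ce_vsub e)) x.
Proof.
have E : tmap (tens_ev N) h \o tassocV =1
    tmap (lin_id N) (tunitl \o tmap Ce_counit h).
  apply: tens3r_ext => n p c /=.
  by rewrite tassocVE !tmapE /= !tmapE tunitrE tunitlE pureZl pureZr.
rewrite [LHS]E tmap_comp; apply: eq_tmap => // p; exact: Ce_rcoact_counit.
Qed.

Lemma tens_ev_reconstruct N (x : tens N (Ce e)) :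
  tmap (tens_ev N) (to_Ce e) (tens_coact (Ce e) N x) = x.
Proof.
rewrite tens_ev_coact tmap_id // => p.
have [c <-] := to_image_surj p; exact: to_Ce_ract.
Qed.

(* The counit TS(N) -> N, seen as a map on S(N). *)
Definition section_ev N : {linear section_functor N -> N} :=
  tens_ev N \o vsub_incl (cotensor (Ce e) N).

Lemma section_coactE N (x : section_functor N) :
  tmap (vsub_incl (cotensor (Ce e) N)) (lin_id C) (coact x) =
  tens_coact (Ce e) N (vsub_incl (cotensor (Ce e) N) x).
Proof. exact: sub_coactE. Qed.

Lemma cotensorP N (x : tens N (Ce e)) : cotensor (Ce e) N x <->
  tassoc (tmap coact (lin_id _) x) = tmap (lin_id N) lcoact x.
Proof.
by split=> [/eqP|h]; [rewrite subr_eq0 => /eqP|apply/eqP; rewrite subr_eq0; apply/eqP].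
Qed.

(** The cotensor condition trades the coaction of N for the left coaction of Ce. Evaluated on its Ce
    factor, the latter becomes ce |-> ece. *)
Lemma section_ev_colinear N : corner_colinear (section_ev N).
Proof.
move=> x; have /cotensorP xE := vsub_valP x.
transitivity (tmap (tens_ev N) (to_corner e)
    (tens_coact (Ce e) N (vsub_val x))); last first.
  by rewrite -section_coactE tmap_comp; exact: eq_tmap.
rewrite tens_ev_coact [LHS]tunitr_nat.
transitivity (tmap (lin_id N) (tunitr \o tmap (lin_id (corner e)) Ce_counit)
    (tassoc (tmap coact (lin_id (Ce e)) (vsub_val x)))).
  by rewrite -tunitr_assoc !tmap_comp; congr (tunitr _); exact: eq_tmap.
rewrite xE tmap_comp; apply: eq_tmap => // p; exact: Ce_lcoact_counit.
Qed.

(** The uniqueness half of the adjunction: by [tens_ev_reconstruct], the value h m is the image of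
    the coaction of m under (ev h) (x) [to_Ce], hence depends on h through ev h only. *)
Lemma section_ev_ext M N (f g : comod_hom M (section_functor N)) :
  (forall m, section_ev N (f m) = section_ev N (g m)) -> f =1 g.
Proof.
move=> fg m; apply: (@vsub_incl_inj K _ (cotensor (Ce e) N)).
have rec (h : comod_hom M (section_functor N)) :
    vsub_incl (cotensor (Ce e) N) (h m) =
    tmap (section_ev N \o h) (to_Ce e) (coact m).
  rewrite -[LHS]tens_ev_reconstruct -section_coactE hom_coact !tmap_comp.
  exact: eq_tmap.
rewrite !rec; exact: eq_tmap.
Qed.

Section Transpose.
Context M N (f : {linear M -> N}) (fC : corner_colinear f).

(** In Sweedler notation, m |-> f(m_(0)) (x) m_(1) e. *)
Definition transpose_fun : {linear M -> tens_comodule (Ce e) N} :=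
  tmap f (to_Ce e) \o coact.

Lemma transpose_coact m :
  coact (transpose_fun m) = tmap transpose_fun (lin_id C) (coact m).
Proof.
transitivity (tassocV (tmap f (tmap (to_Ce e) (lin_id C))
    (tmap (lin_id M) comul (coact m)))).
  transitivity (tassocV (tmap (lin_id N) (@rcoact K _ _ (Ce e))
      (tmap f (to_Ce e) (coact m)))) => //.
  rewrite !tmap_comp; congr (tassocV _).
  by apply: eq_tmap => // c; exact: Ce_rcoactE.
by rewrite -coactA tassocV_nat tassocK tmap_comp; exact: eq_tmap.
Qed.

(** Both sides of the cotensor equation are f(m_(0)) (x) e m_(1) e (x) m_(2) e. *)
Lemma transpose_mem m : cotensor (Ce e) N (transpose_fun m).
Proof.
apply/cotensorP; rewrite /= !tmap_comp.
transitivity (tassoc (tmap (tmap f (to_corner e)) (to_Ce e)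
    (tmap coact (lin_id C) (coact m)))).
  by rewrite tmap_comp; congr (tassoc _); exact: eq_tmap.
rewrite tassoc_nat coactA tmap_comp; apply: eq_tmap => // c.
exact/esym/Ce_lcoactE.
Qed.

Definition transpose : comod_hom M (section_functor N) :=
  @hom_corestr K C M (tens_comodule (Ce e) N) (ComodHom transpose_coact)
    (cotensor (Ce e) N) transpose_mem.

Lemma section_ev_transpose m : section_ev N (transpose m) = f m.
Proof.
rewrite -(corner_colinear_eact fC) eactE tunitr_nat tmap_comp /section_ev /= tmap_comp.
congr (tunitr _); apply: eq_tmap => // c; exact: Ce_counitE.
Qed.
End Transpose.

(** This is the inclusion of eCe in Ce, because c |-> ce fixes the elements of eCe. *)
Definition corner_to_Ce : {linear corner e -> Ce e} :=
  to_Ce e \o vsub_incl (corner_vsub e).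

Lemma corner_to_CeE c : corner_to_Ce (to_corner e c) = to_Ce e (lact e c).
Proof. by rewrite -[RHS]to_Ce_ract -lact_ract. Qed.

(** Reconstructing ex from its coaction gives ev(x_(0)) (x) e x_(1) e, which is the coaction of ev x
    once eCe is included in Ce. *)
Lemma section_ev_eq0 N x : section_ev N x = 0 -> eact e (section_functor N) x = 0.
Proof.
move=> x0; apply: (@vsub_incl_inj K _ (cotensor (Ce e) N)).
rewrite -[LHS]tens_ev_reconstruct -section_coactE tmap_comp coact_eact tmap_comp linear0.
transitivity (tmap (lin_id N) corner_to_Ce (coact (section_ev N x))).
  rewrite section_ev_colinear [RHS]tmap_comp; apply: eq_tmap => // c.
  exact/esym/corner_to_CeE.
by rewrite x0 !linear0.
Qed.

Lemma corner_to_Ce_coact d :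
  lcoact (corner_to_Ce d) = tmap (lin_id (corner e)) corner_to_Ce (comul d).
Proof.
have [c <-] : exists c, to_corner e c = d by exact: to_image_surj.
transitivity (tmap (lin_id (corner e)) corner_to_Ce
    (tmap (to_corner e) (to_corner e) (comul c))); last first.
  by congr (tmap _ _ _); exact/esym/corner_comulE.
rewrite corner_to_CeE [LHS]Ce_lcoactE comul_lact !tmap_comp.
apply: eq_tmap => // c'; exact/esym/corner_to_CeE.
Qed.

(** The coaction of n, read in N (x) Ce, is a preimage: coassociativity puts it in the cotensor
    product, and the counit law evaluates it to n. *)
Lemma section_ev_surj N n : exists x, section_ev N x = n.
Proof.
have nS : cotensor (Ce e) N (tmap (lin_id N) corner_to_Ce (coact n)).
  apply/cotensorP.
  transitivity (tmap (lin_id N) (tmap (lin_id (corner e)) corner_to_Ce)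
      (tassoc (tmap coact (lin_id _) (coact n)))).
    rewrite -tassoc_nat !tmap_comp; congr (tassoc _).
    by apply: eq_tmap => // y /=; rewrite tmap_id.
  rewrite coactA !tmap_comp; apply: eq_tmap => // d.
  exact/esym/corner_to_Ce_coact.
exists (vsub_in nS); rewrite /section_ev /= tmap_comp -[RHS]coact1.
congr (tunitr _); apply: eq_tmap => // d.
have [c <-] : exists c, to_corner e c = d by exact: to_image_surj.
rewrite [RHS]corner_counitE -(idem_lact e c) -Ce_counitE.
exact: congr1 (corner_to_CeE c).
Qed.

Lemma section_ev_map N N' (f : comod_hom N N') x :
  section_ev N' (section_map f x) = f (section_ev N x).
Proof.
rewrite /section_ev /= tmap_comp tunitr_nat tmap_comp.
by congr (tunitr _); exact: eq_tmap.
Qed.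
End Adjunction.

(** * Properties of the section functor *)

Section SectionFunctor.
Context (K : fieldType) (C : coalgebra K) (e : dual_idempotent C).
Implicit Types (M : comodule C) (N : comodule (corner e)).

Section Image.
Context N (A : subcomodule (section_functor N)).

Lemma section_image_is_subcomodule :
  is_subcomodule (lin_image (section_ev N \o subcomod_incl A)).
Proof.
apply: lin_image_is_subcomodule; apply: colinear_comp_hom.
exact: section_ev_colinear.
Qed.

Definition section_image : subcomodule N := Subcomodule section_image_is_subcomodule.

Lemma section_image_mem x : A x -> section_image (section_ev N x).
Proof. by move=> Ax; exists (vsub_in Ax). Qed.

Lemma section_imageP n : section_image n -> exists2 x, A x & section_ev N x = n.
Proof. by move=> [a <-]; exists (vsub_val a) => //; exact: vsub_valP. Qed.

(** The inclusion of A and the zero morphism then agree after ev, so they are equal. *)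
Lemma section_image_zero : vsub_zero section_image -> vsub_zero A.
Proof.
move=> A0 x Ax; have [z z0] := hom_zero A (section_functor N).
have E : subcomod_incl A =1 z.
  apply: section_ev_ext => a; rewrite z0 linear0.
  by apply: A0; apply: section_image_mem; exact: vsub_valP.
by have := E (vsub_in Ax); rewrite z0.
Qed.
End Image.

Lemma section_ev_eq N x y : section_ev N x = section_ev N y ->
  eact e (section_functor N) x = eact e (section_functor N) y.
Proof.
move=> xy; apply/eqP; rewrite -subr_eq0 -linearB; apply/eqP/section_ev_eq0.
by rewrite linearB xy subrr.
Qed.

(** Since ev a = ev b forces ea = eb, this element lies in both A and B and vanishes, while ev a =
    ev(ea). *)
Lemma section_ev_meet N (A B : subcomodule (section_functor N)) a b :
  (forall x, A x -> B x -> x = 0) -> A a -> B b ->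
  section_ev N a = section_ev N b -> section_ev N a = 0.
Proof.
move=> AB Aa Bb ab; rewrite -(corner_colinear_eact (@section_ev_colinear K C e N)).
rewrite (AB (eact e _ a)) ?linear0 //; first exact: subcomod_eact.
by rewrite (section_ev_eq ab); exact: subcomod_eact.
Qed.

Lemma section_torsion_free N : torsion_free e (section_functor N).
Proof.
move=> A /torsionP eA; apply: section_image_zero => _ /section_imageP[x Ax <-].
rewrite -(corner_colinear_eact (@section_ev_colinear K C e N)).
have -> : eact e _ x = subcomod_incl A (eact e A (vsub_in Ax)) by rewrite hom_eact.
by rewrite eA !linear0.
Qed.

Lemma section_indecomposable N : indecomposable N -> indecomposable (section_functor N).
Proof.
move=> [[n n0] Nind]; split.
  by have [x xn] := section_ev_surj n; exists x => x0; rewrite -xn x0 linear0 in n0.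
move=> A B [AB_sum AB_meet].
suff /Nind[/section_image_zero|/section_image_zero] :
    direct_sum2 (section_image A) (section_image B) by [left|right].
split=> [y|_ /section_imageP[a Aa <-] /section_imageP[b Bb /esym]].
  have [x <-] := section_ev_surj y; have [a [b [Aa Bb ->]]] := AB_sum x.
  by exists (section_ev N a), (section_ev N b); rewrite linearD; split=> //;
    exact: section_image_mem.
exact: section_ev_meet AB_meet Aa Bb.
Qed.

Lemma quotient_map_exists M M' (f : comod_hom M M') :
  exists g : comod_hom (quotient_functor e M) (quotient_functor e M'),
    forall m, g (to_quot e M m) = to_quot e M' (f m).
Proof.
have fC := colinear_comp_hom f (@to_quot_colinear K C e M').
by exists (descent fC) => m; rewrite descentE.
Qed.

(** S is right adjoint to T, and T preserves injections: descend f to TM, extend it over TM', and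
    transpose back. *)
Lemma section_injective N : injective_comod N -> injective_comod (section_functor N).
Proof.
move=> N_inj M M' i f iI; have [Ti TiE] := quotient_map_exists i.
have TiI : injective Ti.
  move=> y z; rewrite -(to_quot_val y) -(to_quot_val z) !TiE.
  move=> /(congr1 (vsub_incl _)) yz; congr (to_quot e M _).
  (* Elements of eM are fixed by e, so equality after applying e and i is equality of their images
     under i. *)
  have {yz} : eact e M' (i (vsub_val y)) = eact e M' (i (vsub_val z)) by [].
  by rewrite -!hom_eact !eact_quot => /iI.
have fC := colinear_comp_hom f (@section_ev_colinear K C e N).
have [g gTi] := N_inj _ _ Ti (descent fC) TiI.
have gC := hom_comp_colinear g (@to_quot_colinear K C e M').
exists (transpose gC); apply: (section_ev_ext (f := hom_comp (transpose gC) i)) => m.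
by rewrite [LHS]section_ev_transpose -[RHS](descentE fC) -gTi TiE.
Qed.

(** By adjunction Hom(F, S(N)) is Hom(TF, N), and TF is spanned by the images of a finite spanning
    set of F. *)
Lemma section_quasi_finite N : quasi_finite N -> quasi_finite (section_functor N).
Proof.
move=> N_qf F [d [s sP]].
have [n [h hP]] : fin_dim_hom (quotient_functor e F) N.
  apply: N_qf; exists d, (fun i => to_quot e F (s i)) => y.
  have [a aE] := sP (vsub_val y); exists a; rewrite -(to_quot_val y) aE linear_sum.
  by apply: eq_bigr => i _; rewrite linearZ.
have hC i := hom_comp_colinear (h i) (@to_quot_colinear K C e F).
exists n, (fun i => transpose (hC i)) => f.
have fC := colinear_comp_hom f (@section_ev_colinear K C e N).
have [a aE] := hP (descent fC); exists a.
have [g gE] := hom_lincomb a (fun i => transpose (hC i)).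
move=> x; rewrite -gE; move: x; apply: section_ev_ext => m.
rewrite gE linear_sum -[LHS](descentE fC) aE; apply: eq_bigr => i _.
by rewrite linearZ section_ev_transpose.
Qed.

(** A subcomodule L of TM gives S(L) inside S(TM), which is pulled back to M along the unit [eta];
    simplicity of M then decides between L = 0 and L = TM. *)
Lemma quotient_simple M : simple M -> (exists y : quotient_functor e M, y <> 0) ->
  simple (quotient_functor e M).
Proof.
move=> [_ Msub] M0; split=> // L; pose T := quotient_functor e M.
pose eta := transpose (@to_quot_colinear K C e M).
have etaE m : section_ev T (eta m) = to_quot e M m := section_ev_transpose _ m.
pose SL := section_map (subcomod_incl L).
have [P0|PT] := Msub (preimage eta (hom_image SL)); last first.
  right=> y; rewrite -(to_quot_val y).
  have [z zE] := PT (vsub_val y); rewrite -etaE -zE section_ev_map.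
  exact: vsub_valP.
left=> y Ly; apply: vsub_incl_inj; apply: P0.
(* To place y in the pullback, lift it to z in S(L): the images of z and y in S(TM) agree under ev,
   hence agree after applying e, and e fixes y. *)
have [z zE] := section_ev_surj (vsub_in Ly : L); exists (eact e _ z).
change (SL (eact e _ z) = eta (vsub_val y)); rewrite -[vsub_val y]eact_quot !hom_eact.
by apply: section_ev_eq; rewrite section_ev_map zE etaE to_quot_val.
Qed.

Lemma transpose_injective M N (f : {linear M -> N}) (fC : corner_colinear f) :
  simple M -> (exists m, f m <> 0) -> injective (transpose fC).
Proof.
move=> Ms [m fm]; apply: simple_hom_inj => //; exists m => m0; apply: fm.
by rewrite -(section_ev_transpose fC) m0 linear0.
Qed.

Lemma section_injective_envelope M N : simple M ->
  (exists y : quotient_functor e M, y <> 0) ->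
  injective_envelope (quotient_functor e M) N ->
  injective_envelope M (section_functor N).
Proof.
move=> Ms [y y0] [N_inj [j [jI j_ess]]]; split; first exact: section_injective.
have fC := hom_comp_colinear j (@to_quot_colinear K C e M).
have tI : injective (transpose fC).
  apply: transpose_injective => //; exists (vsub_val y) => jy0.
  by apply: y0; apply: jI; rewrite linear0 -(to_quot_val y).
exists (transpose fC); split=> // A A_meet.
(* Essentiality descends through ev: if A misses the image of M, then ev(A) misses the image of TM,
   so ev(A) = 0 and A = 0. *)
apply: section_image_zero; apply: j_ess => z /section_imageP[a Aa aE].
apply: jI; rewrite linear0 -aE.
apply: (@section_ev_meet N A (hom_image (transpose fC)) a
  (transpose fC (vsub_val z))) => //.
- by move=> w Aw [m mE]; move: Aw; rewrite -mE => /A_meet ->; rewrite linear0.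
- by exists (vsub_val z).
- by rewrite section_ev_transpose aE -[in LHS](to_quot_val z).
Qed.

Lemma socle_section_simple M : simple M ->
  (exists y : quotient_functor e M, y <> 0) ->
  comod_iso (socle (section_functor (quotient_functor e M))) M.
Proof.
move=> Ms M0; have Ts := quotient_simple Ms M0; have [y y0] := M0.
set T := quotient_functor e M in Ts y y0 *.
pose eta := transpose (@to_quot_colinear K C e M).
have etaE m : section_ev T (eta m) = to_quot e M m := section_ev_transpose _ m.
have etaI : injective eta.
  by apply: transpose_injective => //; exists (vsub_val y); rewrite to_quot_val.
have image_simple : simple (hom_image eta).
  apply: (simple_image (f := hom_corestr (A := hom_image eta)
    (lin_image_mem eta))) => //.
    by move=> z; have [m mE] := vsub_valP z; exists m; apply: vsub_incl_inj.
  exists (vsub_in (S := hom_image eta) (lin_image_mem eta (vsub_val y))).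
  move=> /(congr1 (vsub_incl _)) eta0; apply: y0.
  have {}eta0 : eta (vsub_val y) = 0 := eta0.
  by rewrite -(to_quot_val y) -etaE eta0 linear0.
(* A simple A not inside the image of [eta] meets it trivially. As TM is simple, ev(A) is 0, which
   forces A = 0, or contains y = ev(eta y), which contradicts [section_ev_meet]. *)
have simple_sub (A : subcomodule (section_functor T)) :
    simple A -> forall x, A x -> hom_image eta x.
  move=> [[a a0] Asub].
  have [A_meet|AT] := Asub (preimage (subcomod_incl A) (hom_image eta)); last first.
    by move=> x Ax; exact: (AT (vsub_in Ax)).
  have [A0|AT] := Ts.2 (section_image A).
    by case: a0; apply: vsub_incl_inj; apply: section_image_zero A0 _ (vsub_valP a).
  have /section_imageP[b Ab bE] := AT y; case: y0; rewrite -bE.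
  apply: (@section_ev_meet T A (hom_image eta) b (eta (vsub_val y))) => //.
  - by move=> z Az etaz; by have /(congr1 (vsub_incl A)) := A_meet (vsub_in Az) etaz.
  - exact: lin_image_mem.
  - by rewrite etaE to_quot_val.
have eta_soc m : socle (section_functor T) (eta m).
  exists [:: eta m]; rewrite big_seq1; split=> // x; rewrite inE => /eqP ->.
  by exists (hom_image eta); split=> //; exact: lin_image_mem.
apply: comod_iso_sym; apply: (bij_comod_iso (f := hom_corestr eta_soc)).
  by move=> m m' /(congr1 (vsub_incl _)) /etaI.
move=> z; suff [m mE] : hom_image eta (vsub_val z).
  by exists m; apply: vsub_incl_inj.
have [s [-> sP]] := vsub_valP z; elim: s sP => [|x s IHs] sP.
  by rewrite big_nil; exact: vsub0.
rewrite big_cons -[x]scale1r; apply: vsubL.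
  by have [A [As Ax]] := sP x (mem_head _ _); exact: simple_sub As _ Ax.
by apply: IHs => w ws; apply: sP; rewrite inE ws orbT.
Qed.

(** * Functoriality and full faithfulness *)

Lemma section_map_id N : section_map (hom_id N) =1 hom_id (section_functor N).
Proof. by apply: section_ev_ext => x; rewrite [LHS]section_ev_map. Qed.

Lemma section_map_comp N1 N2 N3 (g : comod_hom N2 N3) (f : comod_hom N1 N2) :
  section_map (hom_comp g f) =1 hom_comp (section_map g) (section_map f).
Proof.
apply: section_ev_ext => x; rewrite section_ev_map.
transitivity (g (section_ev N2 (section_map f x))); first by rewrite section_ev_map.
exact/esym/section_ev_map.
Qed.

Lemma section_faithful N1 N2 (f g : comod_hom N1 N2) :
  section_map f =1 section_map g -> f =1 g.
Proof.
by move=> fg n; have [x <-] := section_ev_surj n; rewrite -!section_ev_map fg.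
Qed.

(** Set f(ev x) = ev(h x). This is well defined: ev x determines ex, and ev(h x) = ev(h(ex)). *)
Lemma section_full N1 N2 (h : comod_hom (section_functor N1) (section_functor N2)) :
  exists f : comod_hom N1 N2, section_map f =1 h.
Proof.
have ev_h x y : section_ev N1 x = section_ev N1 y ->
    section_ev N2 (h x) = section_ev N2 (h y).
  move=> /section_ev_eq xy.
  rewrite -(corner_colinear_eact (@section_ev_colinear K C e N2)) -hom_eact xy.
  by rewrite hom_eact (corner_colinear_eact (@section_ev_colinear K C e N2)).
have /choice[s sK] := @section_ev_surj K C e N1.
pose f n := section_ev N2 (h (s n)).
have fE x : f (section_ev N1 x) = section_ev N2 (h x) by apply: ev_h; rewrite sK.
have fL : linear f.
  by move=> a n n'; rewrite -(sK n) -(sK n') -linearP !fE !linearP.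
have fC n : coact (lin_of fL n) = tmap (lin_of fL) (lin_id (corner e)) (coact n).
  rewrite -(sK n) [lin_of fL _]fE !section_ev_colinear hom_coact !tmap_comp.
  by apply: eq_tmap => // x; exact/esym/fE.
exists (ComodHom fC); apply: section_ev_ext => x; rewrite section_ev_map.
exact: fE.
Qed.

(** Functoriality gives one direction. For the other, fullness lifts both inverse morphisms, and
    their composites are compared through the surjection ev. *)
Lemma section_iso N1 N2 :
  comod_iso N1 N2 <-> comod_iso (section_functor N1) (section_functor N2).
Proof.
split=> [[f [g [fK gK]]]|[h [k [hK kK]]]].
  have cancel_map N N' (u : comod_hom N N') (v : comod_hom N' N) :
      cancel u v -> cancel (section_map u) (section_map v).
    move=> uK x; rewrite -[LHS]section_map_comp.
    apply: (section_ev_ext (g := hom_id _)) => {}x; rewrite section_ev_map.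
    exact: uK.
  by exists (section_map f), (section_map g); split; exact: cancel_map.
have [f fE] := section_full h; have [g gE] := section_full k.
exists f, g; split=> n; have [x <-] := section_ev_surj n.
  by rewrite -!section_ev_map fE gE hK.
by rewrite -!section_ev_map gE fE kK.
Qed.
End SectionFunctor.

Theorem proposition3p2 (K : fieldType) (C : coalgebra K)
    (C_basic : basic C) (C_indec : indecomposable_coalgebra C)
    (I : Type) (S E : I -> comodule C)
    (S_complete : complete_simples S)
    (E_envelope : forall x, injective_envelope (S x) (E x))
    (e : dual_idempotent C)
    (Ebar : I -> comodule (corner e))
    (Ebar_envelope : forall x, index_in e S x ->
       injective_envelope (quotient_functor e (S x)) (Ebar x)) :
  (* (a) *)
  (forall N : comodule (corner e),
     injective_comod N -> injective_comod (section_functor N)) /\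
  (* (b) *)
  (forall N : comodule (corner e), quasi_finite N -> indecomposable N ->
     indecomposable (section_functor N)) /\
  (* (c) *)
  (forall N : comodule (corner e), injective_comod N -> indecomposable N ->
     injective_comod (section_functor N) /\ indecomposable (section_functor N)) /\
  (* (d) *)
  (forall x, index_in e S x ->
     comod_iso (socle (section_functor (quotient_functor e (S x)))) (S x)) /\
  (* (e) *)
  (forall x, index_in e S x ->
     torsion_free e (section_functor (quotient_functor e (S x)))) /\
  (* (f) *)
  (forall x, index_in e S x -> comod_iso (section_functor (Ebar x)) (E x)) /\
  (* (g) *)
  (forall N : comodule (corner e), quasi_finite N ->
     quasi_finite (section_functor N)) /\
  (* (h) *)
  ((forall N : comodule (corner e), quasi_finite N ->
      quasi_finite (section_functor N)) /\
   (forall N : comodule (corner e), quasi_finite N ->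
      section_map (hom_id N) =1 hom_id (section_functor N)) /\
   (forall (N1 N2 N3 : comodule (corner e))
      (g : comod_hom N2 N3) (f : comod_hom N1 N2),
      quasi_finite N1 -> quasi_finite N2 -> quasi_finite N3 ->
      section_map (hom_comp g f) =1 hom_comp (section_map g) (section_map f)) /\
   (forall (N1 N2 : comodule (corner e)) (f g : comod_hom N1 N2),
      quasi_finite N1 -> quasi_finite N2 ->
      section_map f =1 section_map g -> f =1 g) /\
   (forall (N1 N2 : comodule (corner e))
      (h : comod_hom (section_functor N1) (section_functor N2)),
      quasi_finite N1 -> quasi_finite N2 ->
      exists f : comod_hom N1 N2, section_map f =1 h) /\
   (forall N : comodule (corner e), quasi_finite N -> indecomposable N ->
      indecomposable (section_functor N)) /\
   (forall N1 N2 : comodule (corner e), quasi_finite N1 -> quasi_finite N2 ->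
      (comod_iso N1 N2 <-> comod_iso (section_functor N1) (section_functor N2)))).
Proof.
have S_simple : forall x, simple (S x) by case: S_complete.
have qf := @section_quasi_finite K C e.
split; first exact: section_injective.
split; first by move=> N _; exact: section_indecomposable.
split.
  by move=> N ? ?; split; [exact: section_injective|exact: section_indecomposable].
split; first by move=> x; exact: socle_section_simple.
split; first by move=> x _; exact: section_torsion_free.
split.
  (* Both comodules are injective envelopes of S_x, the first by transposing the envelope of
     T(S_x). *)
  move=> x xe; apply: injective_envelope_unique (E_envelope x).
  exact: section_injective_envelope (Ebar_envelope x xe).
split; first exact: qf.
split; first exact: qf.
split; first by move=> N _; exact: section_map_id.
split; first by move=> N1 N2 N3 g f _ _ _; exact: section_map_comp.
split; first by move=> N1 N2 f g _ _; exact: section_faithful.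
split; first by move=> N1 N2 h _ _; exact: section_full.
split; first by move=> N _; exact: section_indecomposable.
by move=> N1 N2 _ _; exact: section_iso.
Qed.
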